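(* Let $\mathcal{F}$ be a saturated fusion system on a finite $p$-group $S$, let $\mathcal{T}$ be a transporter system associated to $\mathcal{F}$, let $X$ be a finite set, and let $\theta:\pi_1(|\mathcal{T}|)\to\Sigma_X$ be a homomorphism, equivalently a map $\theta:\mathrm{Mor}(\mathcal{T})\to\Sigma_X$ sending composition to multiplication and inclusions to the identity. Then the fusion action system $\mathfrak{X}^\theta$ of $S$ on $X$ is $\mathrm{Ob}(\mathcal{T})$-saturated.
   Context: $p$ is a prime; $\Sigma_X$ is the symmetric group on $X$; $c_s$ is conjugation $h\mapsto shs^{-1}$; $\mathrm{Inj}(P,Q)$ is the set of injective homomorphisms. A fusion system $\mathcal{F}$ on $S$ is a category whose objects are all subgroups of $S$, with $\mathcal{F}(P,Q)\subseteq\mathrm{Inj}(P,Q)$ containing all $c_s|_P$ for $s\in S$, $sPs^{-1}\le Q$, such that every morphism factors as an isomorphism of $\mathcal{F}$ followed by an inclusion. Subgroups isomorphic in $\mathcal{F}$ are $\mathcal{F}$-conjugate. $P$ is fully normalized (centralized) if $|N_S(P)|\ge|N_S(Q)|$ (resp. $|Z_S(P)|\ge|Z_S(Q)|$) for all $Q$ conjugate to $P$. $\mathrm{Aut}_S(P)=\{c_s|_P:s\in N_S(P)\}$. $\mathcal{F}$ is saturated if every fully normalized $P$ is fully centralized with $\mathrm{Aut}_S(P)\in\mathrm{Syl}_p(\mathcal{F}(P))$, and for every fully centralized $Q$ and isomorphism $\varphi\in\mathcal{F}(P,Q)$ there is $\widetilde\varphi\in\mathcal{F}(N_\varphi,S)$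 extending $\varphi$, where $N_\varphi=\{n\in N_S(P):\varphi c_n\varphi^{-1}\in\mathrm{Aut}_S(Q)\}$. For a set $\mathcal{H}$ of subgroups of $S$, $\mathcal{T}_S^{\mathcal{H}}(S)$ is the category with object set $\mathcal{H}$ and morphisms $N_S(P,Q)=\{s\in S:sPs^{-1}\le Q\}$. An (abstract) transporter system associated to $\mathcal{F}$ is a category $\mathcal{T}$ whose objects are a set of subgroups of $S$ closed under $\mathcal{F}$-conjugacy and overgroups, with functors $\mathcal{T}_S^{\mathrm{Ob}(\mathcal{T})}(S)\xrightarrow{\delta}\mathcal{T}\xrightarrow{\pi}\mathcal{F}$ (write $\widehat s=\delta_{P,Q}(s)$, $c_{\mathfrak{g}}=\pi_{P,Q}(\mathfrak{g})$) such that: (A1) on objects $\delta$ is the identity and $\pi$ the inclusion; (A2) with $E(P)=\ker[\mathcal{T}(P)\to\mathcal{F}(P)]$, $E(P)$ acts right-freely and $E(Q)$ left-freely on $\mathcal{T}(P,Q)$, and $\pi_{P,Q}$ is the orbit map of the $E(P)$-action; (B) $\delta$ is injective on morphisms and $c_{\widehat s}=c_s$; (C) $\widehat{c_{\mathfrak{g}}(p)}\circ\mathfrak{g}=\mathfrak{g}\circ\widehat p$ for $\mathfrak{g}\in\mathcal{T}(P,Q)$, $p\in P$; (I) $\delta_{S,S}(S)\in\mathrm{Syl}_p(\mathcal{T}(S))$; (II) for every isomorphism $\mathfrak{g}\in\mathcal{T}(P,Q)$ and $P\trianglelefteq\widetilde P\le S$, $Q\trianglelefteq\widetilde Q\le S$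 with $\mathfrak{g}\,\delta_{P,P}(\widetilde P)\,\mathfrak{g}^{-1}\le\delta_{Q,Q}(\widetilde Q)$, there is $\widetilde{\mathfrak{g}}\in\mathcal{T}(\widetilde P,\widetilde Q)$ with $\widetilde{\mathfrak{g}}\circ\delta_{P,\widetilde P}(1)=\delta_{Q,\widetilde Q}(1)\circ\mathfrak{g}$. The inclusions of $\mathcal{T}$ are the morphisms $\delta_{P,Q}(1)$, $P\le Q$. $S$ acts on $X$ by $\ell_s=\theta(\delta_{S,S}(s))$. A pair $(\varphi,\sigma)\in\mathrm{Inj}(P,Q)\times\Sigma_X$ is intertwined if $\sigma\ell_p\sigma^{-1}=\ell_{\varphi(p)}$ for all $p\in P$. A fusion action system of $S$ on $X$ is a category $\mathfrak{X}$ whose objects are all subgroups of $S$, whose morphisms $P\to Q$ are intertwined pairs (composed componentwise), containing all $(c_s|_P,\ell_s)$ with $s\in S$, $sPs^{-1}\le Q$, and in which every morphism factors as an isomorphism of $\mathfrak{X}$ followed by an inclusion $(\mathrm{incl},\mathrm{id}_X)$. $\mathfrak{X}^\theta$ has, for $P,Q\in\mathrm{Ob}(\mathcal{T})$, $\mathfrak{X}^\theta(P,Q)=\{(c_{\mathfrak{g}},\theta(\mathfrak{g})):\mathfrak{g}\in\mathcal{T}(P,Q)\}$, and is regarded as a fusion action system of $S$ on $X$ by taking the one generated by these morphisms (allowing restrictions of morphisms to subgroups not in $\mathrm{Ob}(\mathcal{T})$). For a fusion action system $\mathfrak{X}$: $\mathfrak{X}(P)=\mathfrak{X}(P,P)$;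 $\mathcal{F}^{\mathfrak{X}}(P,Q)=\{\varphi:\exists\sigma,(\varphi,\sigma)\in\mathfrak{X}(P,Q)\}$ is the underlying fusion system, conjugacy meaning isomorphism in it; $C=\{s\in S:\ell_s=\mathrm{id}_X\}$; $N_S(P;X)=N_S(P)\cap C$; $Z_S(P;X)=Z_S(P)\cap C$. $P$ is fully normalized (resp. fully centralized, fully $X$-normalized, fully $X$-centralized) if the order of $N_S(P)$ (resp. $Z_S(P)$, $N_S(P;X)$, $Z_S(P;X)$) is maximal over the conjugacy class of $P$. Put $\mathrm{Aut}_S(P;X)=\{(c_s|_P,\ell_s):s\in N_S(P)\}$, $\Sigma_{\mathfrak{X}}(P)=\{\sigma:\exists\varphi,(\varphi,\sigma)\in\mathfrak{X}(P)\}$, $\Sigma^S_{\mathfrak{X}}(P)=\{\ell_s:s\in N_S(P)\}$, $\mathcal{F}^{\mathfrak{X}}(P)_0=\{\varphi:(\varphi,\mathrm{id}_X)\in\mathfrak{X}(P)\}$, $\mathcal{F}_S(P)_0=\{c_s|_P:s\in N_S(P;X)\}$, $\Sigma_{\mathfrak{X}}(P)_0=\{\sigma:(\mathrm{id}_P,\sigma)\in\mathfrak{X}(P)\}$, $\Sigma^S_{\mathfrak{X}}(P)_0=\{\ell_s:s\in Z_S(P)\}$, and for an isomorphism $(\varphi,\sigma)\in\mathfrak{X}(P,Q)$, $N_{(\varphi,\sigma)}=\{n\in N_S(P):(\varphi c_n\varphi^{-1},\sigma\ell_n\sigma^{-1})\in\mathrm{Aut}_S(Q;X)\}$. For a collection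 $\mathcal{H}$ of subgroups of $S$ closed under $\mathcal{F}^{\mathfrak{X}}$-conjugacy and overgroups, $\mathfrak{X}$ is $\mathcal{H}$-saturated if the following hold for all subgroups in $\mathcal{H}$: (1) for $P\in\mathcal{H}$, fully normalized implies fully $X$-normalized and fully centralized, and each of these two implies fully $X$-centralized; (2) if $P\in\mathcal{H}$ is fully normalized then $\mathrm{Aut}_S(P)\in\mathrm{Syl}_p(\mathcal{F}^{\mathfrak{X}}(P))$, $\mathrm{Aut}_S(P;X)\in\mathrm{Syl}_p(\mathfrak{X}(P))$, $\Sigma^S_{\mathfrak{X}}(P)\in\mathrm{Syl}_p(\Sigma_{\mathfrak{X}}(P))$; (3) if $P\in\mathcal{H}$ is fully $X$-normalized then $\mathcal{F}_S(P)_0\in\mathrm{Syl}_p(\mathcal{F}^{\mathfrak{X}}(P)_0)$; (4) if $P\in\mathcal{H}$ is fully centralized then $\Sigma^S_{\mathfrak{X}}(P)_0\in\mathrm{Syl}_p(\Sigma_{\mathfrak{X}}(P)_0)$; (5) if $Q\in\mathcal{H}$ is fully $X$-centralized and $(\varphi,\sigma)\in\mathfrak{X}(P,Q)$ is an isomorphism, there is $(\widetilde\varphi,\sigma)\in\mathfrak{X}(N_{(\varphi,\sigma)},S)$ with $\widetilde\varphi|_P=\varphi$.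
   Formalization: The transporter system T is required to have finite morphism sets and S among its objects; without finiteness the claim fails, e.g. for the transporter category of (Z/p)*Z on {1, Z/p} with θ killing Z/p and sending the generator of Z to a p-cycle. *)

(* Defs.v *)
From HB Require Import structures.
From mathcomp Require Import all_boot all_fingroup all_solvable.
From mathcomp Require Import boolp.

Set Implicit Arguments.
Unset Strict Implicit.
Unset Printing Implicit Defensive.

Local Open Scope group_scope.

(* Conventions.

   The p-group S is a whole finite group type gT, that is, S = [set: gT], so
   that the subgroups of S are the P : {group gT}.

   A homomorphism defined on P is a finite function gT -> gT taking the value 1
   outside P.  With this normalization two homomorphisms on P are equal iff
   they agree on P, composition is plain composition of functions, and the
   inclusion of P in any larger subgroup is represented by idf P.

   Homomorphisms and permutations act on the left in the mathematics, whereas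
   the library's product of permutations is (s * t) x = t (s x): the composite
   "sigma after tau" is therefore written tau * sigma, and sigma l sigma^-1 is
   written l ^ sigma (= sigma^-1 * l * sigma in the library's order). *)

Section Homs.
Variable gT : finGroupType.
Implicit Types (P Q R : {group gT}) (f g : {ffun gT -> gT}) (s : gT).

Definition resf P (f : gT -> gT) : {ffun gT -> gT} :=
  [ffun x => if x \in P then f x else 1].

Definition idf P := resf P id.

Definition conjf P s := resf P (fun x => s * x * s^-1).

Definition fcomp g f : {ffun gT -> gT} := [ffun x => g (f x)].

(* The inverse f @: P -> P of an injective f on P. *)
Definition invf P f : {ffun gT -> gT} :=
  [ffun y => odflt 1 [pick x in P | f x == y]].

Definition Inj P Q : {set {ffun gT -> gT}} :=
  [set f : {ffun gT -> gT} |
    [&& [forall (x | x \notin P), f x == 1], morphic P f, dinjectiveb f P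
      & f @: P \subset Q]].

(* N_S(P, Q) = {s | s P s^-1 <= Q}. *)
Definition transp P Q : {set gT} := [set s | P :^ s^-1 \subset Q].

Definition ntrans P Q := {s : gT | s \in transp P Q}.

Lemma transp1 P Q : P \subset Q -> 1 \in transp P Q.
Proof. by rewrite inE invg1 conjsg1. Qed.

Lemma transpM P Q R s t :
  s \in transp P Q -> t \in transp Q R -> t * s \in transp P R.
Proof.
rewrite !inE invMg conjsgM => sPQ sQR; apply: subset_trans sQR.
by rewrite conjSg.
Qed.

Lemma transpT P s : s \in transp P [set: gT].
Proof. by rewrite inE subsetT. Qed.

Definition trans_incl P Q (sPQ : P \subset Q) : ntrans P Q :=
  exist _ 1 (transp1 sPQ).

Definition trans_comp P Q R (t : ntrans Q R) (s : ntrans P Q) : ntrans P R :=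
  exist _ (val t * val s) (transpM (valP s) (valP t)).

Definition trans_top s : ntrans [set: gT] [set: gT] := exist _ s (transpT _ s).

(* A set A of automorphisms of P, as a set of elements of the group Aut P. *)
Definition perms_of P (A : {set {ffun gT -> gT}}) : {set {perm gT}} :=
  [set a in Aut P | resf P a \in A].

End Homs.

Section Iso.
Variables (gT : finGroupType).
Variable F : {group gT} -> {group gT} -> {set {ffun gT -> gT}}.

Definition fiso (P Q : {group gT}) (f : {ffun gT -> gT}) :=
  f \in F P Q /\
  exists h, [/\ h \in F Q P, fcomp h f = idf P & fcomp f h = idf Q].

End Iso.

Record fusion_system (gT : finGroupType) := FusionSystem {
  fhom :> {group gT} -> {group gT} -> {set {ffun gT -> gT}};
  fhom_inj : forall P Q, fhom P Q \subset Inj P Q;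
  fhom_comp : forall P Q R f g,
    f \in fhom P Q -> g \in fhom Q R -> fcomp g f \in fhom P R;
  fhom_conj : forall P Q s, s \in transp P Q -> conjf P s \in fhom P Q;
  fhom_factor : forall P Q f, f \in fhom P Q ->
    exists (R : {group gT}) (g : {ffun gT -> gT}),
      [/\ R \subset Q, fiso fhom P R g & f = fcomp (idf R) g] }.

Section Fusion.
Variables (p : nat) (gT : finGroupType) (F : fusion_system gT).
Implicit Types P Q : {group gT}.

Definition fconj P Q := exists f, fiso F P Q f.

Definition max_in_class (m : {group gT} -> nat) P :=
  forall Q, fconj P Q -> (m Q <= m P)%N.

Definition fully_normalized := max_in_class (fun P => #|'N(P)|).
Definition fully_centralized := max_in_class (fun P => #|'C(P)|).

Definition conjS P := [set conjf P s | s in 'N(P)].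
Definition autS P := perms_of P (conjS P).
Definition autF P := perms_of P (F P P).

(* N_f, for f an isomorphism from P to Q. *)
Definition Nf P Q f : {set gT} :=
  [set n in 'N(P) | fcomp f (fcomp (conjf P n) (invf P f)) \in conjS Q].

(* When f : P -> Q is an isomorphism Nf P Q f is a subgroup, hence equal to
   the subgroup it generates. *)
Definition saturated :=
  (forall P, fully_normalized P ->
     fully_centralized P /\ p.-Sylow(autF P) (autS P)) /\
  (forall P Q f, fully_centralized Q -> fiso F P Q f ->
     exists2 g, g \in F <<Nf P Q f>>%G [set: gT]%G & resf P g = f).

End Fusion.

Record fin_category (O : Type) := FinCategory {
  hom :> O -> O -> finType;
  idm : forall P, hom P P;
  comp : forall {P Q R}, hom Q R -> hom P Q -> hom P R;
  comp1m : forall P Q (g : hom P Q), comp (idm Q) g = g;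
  compm1 : forall P Q (g : hom P Q), comp g (idm P) = g;
  compA : forall P Q R U (k : hom R U) (h : hom Q R) (g : hom P Q),
    comp k (comp h g) = comp (comp k h) g }.

Section AutGroup.
Variables (O : Type) (C : fin_category O) (P : O).

(* The automorphism group of P in C; an automorphism is given together with
   its inverse. *)
Definition cat_aut :=
  {u : C P P * C P P | (comp u.1 u.2 == idm C P) && (comp u.2 u.1 == idm C P)}.

HB.instance Definition _ := Finite.on cat_aut.

Definition aut_mor (u : cat_aut) : C P P := (val u).1.

Fact cat_aut1_subproof :
  (comp (idm C P) (idm C P) == idm C P) && (comp (idm C P) (idm C P) == idm C P).
Proof. by rewrite comp1m eqxx. Qed.
Definition cat_aut1 : cat_aut := exist _ (idm C P, idm C P) cat_aut1_subproof.

Fact cat_autV_subproof (u : cat_aut) :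
  (comp (val u).2 (val u).1 == idm C P) && (comp (val u).1 (val u).2 == idm C P).
Proof. by rewrite andbC (valP u). Qed.
Definition cat_autV (u : cat_aut) : cat_aut :=
  exist _ ((val u).2, (val u).1) (cat_autV_subproof u).

Fact cat_autM_subproof (u v : cat_aut) :
  (comp (comp (val u).1 (val v).1) (comp (val v).2 (val u).2) == idm C P) &&
  (comp (comp (val v).2 (val u).2) (comp (val u).1 (val v).1) == idm C P).
Proof.
case: u v => -[a a'] /= /andP[/eqP e1 /eqP e2] [[b b'] /= /andP[/eqP e3 /eqP e4]].
by rewrite -!compA (compA b) e3 comp1m e1 (compA a') e2 comp1m e4 !eqxx.
Qed.
Definition cat_autM (u v : cat_aut) : cat_aut :=
  exist _ (comp (val u).1 (val v).1, comp (val v).2 (val u).2)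
          (cat_autM_subproof u v).

Fact cat_autMA : associative cat_autM.
Proof. by move=> u v w; apply: val_inj; rewrite /= !compA. Qed.
Fact cat_aut1M : left_id cat_aut1 cat_autM.
Proof. by case=> -[a b] ab; apply: val_inj; rewrite /= comp1m compm1. Qed.
Fact cat_autVM : left_inverse cat_aut1 cat_autV cat_autM.
Proof.
by case=> -[a b] /= ab; apply: val_inj; case/andP: (ab) => _ /eqP /= ->.
Qed.

HB.instance Definition _ :=
  Finite_isGroup.Build cat_aut cat_autMA cat_aut1M cat_autVM.

End AutGroup.

Definition objs (gT : finGroupType) (H : {set {group gT}}) :=
  {P : {group gT} | P \in H}.

Definition obj_group (gT : finGroupType) (H : {set {group gT}}) (P : objs H) :
  {group gT} := val P.

Coercion obj_group : objs >-> group_of.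

Definition closed_conj_over (gT : finGroupType) (F : fusion_system gT)
    (H : {set {group gT}}) :=
  (forall P Q, P \in H -> fconj F P Q -> Q \in H) /\
  (forall P Q : {group gT}, P \in H -> P \subset Q -> Q \in H).

(* delta and pi are families of maps on morphism sets because they are the
   identity, resp. the inclusion, on objects.  The kernel E(P) consists of the
   e : T(P, P) with pi e = idf P.  Morphism sets are finite, and S is an object,
   as the Sylow condition on T(S) presupposes. *)
Record transporter_system (p : nat) (gT : finGroupType)
    (F : fusion_system gT) := TransporterSystem {
  ts_ob : {set {group gT}};
  ts_obT : [set: gT]%G \in ts_ob;
  ts_ob_closed : closed_conj_over F ts_ob;
  ts_cat :> fin_category (objs ts_ob);
  ts_delta : forall {P Q : objs ts_ob}, ntrans P Q -> ts_cat P Q;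
  ts_pi : forall {P Q : objs ts_ob}, ts_cat P Q -> {ffun gT -> gT};
  ts_delta1 : forall P : objs ts_ob,
    ts_delta (trans_incl (subxx P)) = idm ts_cat P;
  ts_deltaM : forall (P Q R : objs ts_ob) (t : ntrans Q R) (s : ntrans P Q),
    ts_delta (trans_comp t s) = comp (ts_delta t) (ts_delta s);
  ts_pi_hom : forall (P Q : objs ts_ob) (g : ts_cat P Q), ts_pi g \in F P Q;
  ts_pi1 : forall P : objs ts_ob, ts_pi (idm ts_cat P) = idf P;
  ts_piM : forall (P Q R : objs ts_ob) (h : ts_cat Q R) (g : ts_cat P Q),
    ts_pi (comp h g) = fcomp (ts_pi h) (ts_pi g);
  ts_free_r : forall (P Q : objs ts_ob) (g : ts_cat P Q) (e : ts_cat P P),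
    ts_pi e = idf P -> comp g e = g -> e = idm ts_cat P;
  ts_free_l : forall (P Q : objs ts_ob) (g : ts_cat P Q) (e : ts_cat Q Q),
    ts_pi e = idf Q -> comp e g = g -> e = idm ts_cat Q;
  ts_pi_surj : forall (P Q : objs ts_ob) f, f \in F P Q ->
    exists g : ts_cat P Q, ts_pi g = f;
  ts_pi_orbit : forall (P Q : objs ts_ob) (g g' : ts_cat P Q),
    ts_pi g = ts_pi g' <->
    exists2 e : ts_cat P P, ts_pi e = idf P & g' = comp g e;
  ts_delta_inj : forall P Q : objs ts_ob, injective (@ts_delta P Q);
  ts_pi_delta : forall (P Q : objs ts_ob) (s : ntrans P Q),
    ts_pi (ts_delta s) = conjf P (val s);
  ts_C : forall (P Q : objs ts_ob) (g : ts_cat P Q)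
      (x : ntrans P P) (y : ntrans Q Q),
    val x \in P -> val y = ts_pi g (val x) ->
    comp (ts_delta y) g = comp g (ts_delta x);
  ts_Sylow : let S : objs ts_ob := exist _ [set: gT]%G ts_obT in
    p.-Sylow([set: cat_aut ts_cat S])
      [set u : cat_aut ts_cat S |
        [exists s : gT, aut_mor u == @ts_delta S S (trans_top s)]];
  ts_extend : forall (P Q P' Q' : objs ts_ob) (g : ts_cat P Q) (h : ts_cat Q P)
      (nPP' : P <| P') (nQQ' : Q <| Q'),
    comp h g = idm ts_cat P -> comp g h = idm ts_cat Q ->
    (forall s : ntrans P P, val s \in P' ->
      exists2 t : ntrans Q Q, val t \in Q' &
        comp (comp g (ts_delta s)) h = ts_delta t) ->
    exists g' : ts_cat P' Q',
      comp g' (ts_delta (trans_incl (normal_sub nPP')))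
      = comp (ts_delta (trans_incl (normal_sub nQQ'))) g }.

Arguments ts_delta {p gT F} t P Q _ : rename.

Definition ts_top p gT (F : fusion_system gT) (T : transporter_system p F) :
  objs (ts_ob T) := exist _ [set: gT]%G (ts_obT T).

(* A left action of the group gT on X; in the library's product order. *)
Record laction (gT : finGroupType) (X : finType) := LAction {
  lact :> gT -> {perm X};
  lactM : forall s t, lact (s * t) = lact t * lact s }.

Section Pairs.
Variables (gT : finGroupType) (X : finType).

Definition pairs : finType := ({ffun gT -> gT} * {perm X})%type.

Definition pcomp (n m : pairs) : pairs := (fcomp n.1 m.1, m.2 * n.2).

Definition idp (P : {group gT}) : pairs := (idf P, 1).

Definition intertwined (l : laction gT X) (P Q : {group gT}) : {set pairs} :=
  [set m : pairs | (m.1 \in Inj P Q) && [forall (x | x \in P), l x ^ m.2 == l (m.1 x)]].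

End Pairs.

Section XIso.
Variables (gT : finGroupType) (X : finType).
Variable A : {group gT} -> {group gT} -> {set pairs gT X}.

Definition xiso (P Q : {group gT}) (m : pairs gT X) :=
  m \in A P Q /\
  exists k, [/\ k \in A Q P, pcomp k m = idp X P & pcomp m k = idp X Q].

End XIso.

Record fusion_action_system (gT : finGroupType) (X : finType)
    (l : laction gT X) := FusionActionSystem {
  xhom :> {group gT} -> {group gT} -> {set pairs gT X};
  xhom_intertwined : forall P Q, xhom P Q \subset intertwined l P Q;
  xhom_comp : forall P Q R m n,
    m \in xhom P Q -> n \in xhom Q R -> pcomp n m \in xhom P R;
  xhom_conj : forall P Q s, s \in transp P Q -> (conjf P s, l s) \in xhom P Q;
  xhom_factor : forall P Q m, m \in xhom P Q ->
    exists (R : {group gT}) (n : pairs gT X),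
      [/\ R \subset Q, xiso xhom P R n & m = pcomp (idp X R) n] }.

Section Underlying.
Variables (gT : finGroupType) (X : finType) (l : laction gT X).
Variable A : fusion_action_system l.
Implicit Types P Q R : {group gT}.

Definition und_hom P Q : {set {ffun gT -> gT}} := [set m.1 | m in A P Q].

Fact und_inj P Q : und_hom P Q \subset Inj P Q.
Proof.
apply/subsetP=> _ /imsetP[m /(subsetP (xhom_intertwined A P Q)) + ->].
by rewrite inE => /andP[].
Qed.
Fact und_comp P Q R f g :
  f \in und_hom P Q -> g \in und_hom Q R -> fcomp g f \in und_hom P R.
Proof.
case/imsetP=> m Am -> /imsetP[n An ->].
by apply/imsetP; exists (pcomp n m); first exact: xhom_comp Am An.
Qed.
Fact und_conj P Q s : s \in transp P Q -> conjf P s \in und_hom P Q.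
Proof. by move=> Ps; apply/imsetP; exists (conjf P s, l s); first exact: xhom_conj. Qed.
Fact und_factor P Q f : f \in und_hom P Q ->
  exists (R : {group gT}) (g : {ffun gT -> gT}),
    [/\ R \subset Q, fiso und_hom P R g & f = fcomp (idf R) g].
Proof.
case/imsetP=> m /xhom_factor[R [n [sRQ [An [k [Ak kn nk]]] ->]]] ->.
exists R, n.1; split=> //; split; first exact: imset_f.
by exists k.1; split; [apply: imset_f | case: kn | case: nk].
Qed.

Definition underlying : fusion_system gT :=
  FusionSystem und_inj und_comp und_conj und_factor.

End Underlying.

Section HSaturation.
Variables (p : nat) (gT : finGroupType) (X : finType) (l : laction gT X).
Variable A : fusion_action_system l.
Implicit Types P Q : {group gT}.

Let F := underlying A.

Definition act_ker : {set gT} := [set s | l s == 1].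

Definition fully_X_normalized :=
  max_in_class F (fun P => #|'N(P) :&: act_ker|).
Definition fully_X_centralized :=
  max_in_class F (fun P => #|'C(P) :&: act_ker|).

(* A set B of pairs on P, as a set of elements of the group Aut P x Sigma_X. *)
Definition pair_perms_of P (B : {set pairs gT X}) : {set {perm gT} * {perm X}} :=
  [set u | (u.1 \in Aut P) && ((resf P u.1, u.2) \in B)].

Definition conjSX P : {set pairs gT X} := [set (conjf P s, l s) | s in 'N(P)].
Definition autX P := pair_perms_of P (A P P).
Definition autSX P := pair_perms_of P (conjSX P).
Definition sigmaX P : {set {perm X}} := [set m.2 | m in A P P].
Definition sigmaS P : {set {perm X}} := [set l s | s in 'N(P)].
Definition autF0 P :=
  perms_of P [set f : {ffun gT -> gT} | (f, 1 : {perm X}) \in A P P].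
Definition autS0 P := perms_of P [set conjf P s | s in 'N(P) :&: act_ker].
Definition sigmaX0 P : {set {perm X}} := [set a : {perm X} | (idf P, a) \in A P P].
Definition sigmaS0 P : {set {perm X}} := [set l s | s in 'C(P)].

(* N_(f, a), for m = (f, a) an isomorphism from P to Q. *)
Definition Nx P Q (m : pairs gT X) : {set gT} :=
  [set n in 'N(P) |
    (fcomp m.1 (fcomp (conjf P n) (invf P m.1)), l n ^ m.2) \in conjSX Q].

(* As for Nf, Nx P Q m is a subgroup when m is an isomorphism. *)
Record H_saturated (H : {set {group gT}}) : Prop := HSaturated {
  Hsat_closed : closed_conj_over F H;
  Hsat_full : forall P, P \in H ->
    [/\ fully_normalized F P -> fully_X_normalized P,
        fully_normalized F P -> fully_centralized F P,
        fully_X_normalized P -> fully_X_centralized P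
      & fully_centralized F P -> fully_X_centralized P];
  Hsat_normalized : forall P, P \in H -> fully_normalized F P ->
    [/\ p.-Sylow(autF F P) (autS P), p.-Sylow(autX P) (autSX P)
      & p.-Sylow(sigmaX P) (sigmaS P)];
  Hsat_X_normalized : forall P, P \in H -> fully_X_normalized P ->
    p.-Sylow(autF0 P) (autS0 P);
  Hsat_centralized : forall P, P \in H -> fully_centralized F P ->
    p.-Sylow(sigmaX0 P) (sigmaS0 P);
  Hsat_extend : forall P Q m, P \in H -> Q \in H ->
    fully_X_centralized Q -> xiso A P Q m ->
    exists2 g, (g, m.2) \in A <<Nx P Q m>>%G [set: gT]%G & resf P g = m.1 }.

End HSaturation.

Section Generated.
Variables (gT : finGroupType) (X : finType) (l : laction gT X).
Implicit Types P Q R : {group gT}.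

Lemma intertwinedP P Q (m : pairs gT X) :
  reflect [/\ forall x, x \notin P -> m.1 x = 1, {in P &, {morph m.1 : x y / x * y}},
              {in P &, injective m.1}, m.1 @: P \subset Q
            & {in P, forall x, l x ^ m.2 = l (m.1 x)}]
          (m \in intertwined l P Q).
Proof.
rewrite inE [m.1 \in _]inE; apply: (iffP andP).
  case=> /and4P[/forall_inP m1 /morphicP mM /dinjectiveP mI mQ] /forall_inP ml.
  by split=> // [x /m1/eqP | x /ml/eqP].
case=> m1 mM mI mQ ml; split; last by apply/forall_inP=> x /ml->.
apply/and4P; split=> //; first by apply/forall_inP=> x /m1->.
  exact/morphicP.
exact/dinjectiveP.
Qed.

Lemma pcomp_idp P R (m : pairs gT X) :
  m \in intertwined l P R -> pcomp (idp X R) m = m.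
Proof.
case: m => f a /intertwinedP[/= f1 fM _ /subsetP fR _]; congr (_, _).
  apply/ffunP=> x; rewrite !ffunE; case: ifP => // /negP[].
  by have [Px | /f1-> //] := boolP (x \in P); apply/fR/imset_f.
by rewrite mulg1.
Qed.

Lemma pcomp_idr P R (m : pairs gT X) :
  m \in intertwined l P R -> pcomp m (idp X P) = m.
Proof.
case: m => f a /intertwinedP[/= f1 fM _ _ _]; congr (_, _); last first.
  by rewrite mul1g.
apply/ffunP=> x; rewrite !ffunE; case: ifP => // /negbT /f1->.
by apply: (mulgI (f 1)); rewrite -fM ?group1 // !mulg1.
Qed.

Lemma pcompA (k n m : pairs gT X) : pcomp k (pcomp n m) = pcomp (pcomp k n) m.
Proof.
by congr (_, _) => /=; [apply/ffunP=> x; rewrite !ffunE | rewrite mulgA].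
Qed.

Lemma intertwined_inv P R (m : pairs gT X) :
    m \in intertwined l P R -> m.1 @: P = R ->
  let k := (invf P m.1, m.2^-1) in
  [/\ k \in intertwined l R P, pcomp k m = idp X P & pcomp m k = idp X R].
Proof.
case: m => f a /intertwinedP[/= f1 fM fI _ fl] fR.
have f_1 : f 1 = 1 by apply: (mulgI (f 1)); rewrite -fM ?group1 // !mulg1.
have gK x : x \in P -> invf P f (f x) = x.
  move=> Px; rewrite ffunE; case: pickP => [y /andP[Py /eqP /fI-> //]|].
  by move/(_ x); rewrite Px eqxx.
have g1 y : y \notin R -> invf P f y = 1.
  move=> Ry; rewrite ffunE; case: pickP => // x /andP[Px /eqP fx].
  by rewrite -fx -fR imset_f in Ry.
have RP y : y \in R -> exists2 x, x \in P & y = f x.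
  by rewrite -fR => /imsetP[x]; exists x.
split.
- apply/intertwinedP; split=> //=.
  + by move=> _ _ /RP[x Px ->] /RP[y Py ->]; rewrite -fM // !gK ?groupM.
  + by move=> _ _ /RP[x Px ->] /RP[y Py ->]; rewrite !gK // => ->.
  + by apply/subsetP=> _ /imsetP[_ /RP[x Px ->] ->]; rewrite gK.
  + by move=> _ /RP[x Px ->]; rewrite gK // -fl // conjgK.
- congr (_, _); last by rewrite /= mulgV.
  apply/ffunP=> x; rewrite [LHS]ffunE [RHS]ffunE /=; case: ifP => [|/negbT Px].
    exact: gK.
  by rewrite f1 // -{1}f_1 gK.
congr (_, _); last by rewrite /= mulVg.
apply/ffunP=> y; rewrite [LHS]ffunE [RHS]ffunE /=; case: ifP => [/RP[x Px ->]|/negbT Ry].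
  by rewrite gK.
by rewrite g1.
Qed.

Lemma factor_image (A : fusion_action_system l) P Q m R :
    m \in A P Q -> m.1 @: P = R ->
  m \in A P R /\ (invf P m.1, m.2^-1) \in A R P.
Proof.
move=> Am mR; have [R' [n [_ [An [k [Ak kn nk]]] mn]]] := xhom_factor Am.
have AI := subsetP (xhom_intertwined A _ _).
rewrite (pcomp_idp (AI _ _ _ An)) in mn; rewrite -{n}mn in An kn nk.
have [_ _ _ kP _] := intertwinedP _ _ _ (AI _ _ _ Ak).
have {mR} eqR : R' = R.
  apply/val_inj; rewrite /= -mR; apply/eqP; rewrite eq_sym eqEsubset.
  apply/andP; split; first by case/AI/intertwinedP: An.
  apply/subsetP=> y R'y; apply/imsetP; exists (k.1 y).
    exact/(subsetP kP)/imset_f.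
  by case: nk => /ffunP/(_ y); rewrite !ffunE R'y.
have mR' : m.1 @: P = R'.
  apply/eqP; rewrite eqEsubset; apply/andP; split.
    by case/AI/intertwinedP: An.
  apply/subsetP=> y R'y; apply/imsetP; exists (k.1 y).
    exact/(subsetP kP)/imset_f.
  by case: nk => /ffunP/(_ y); rewrite !ffunE R'y.
rewrite -eqR; split=> //.
have [Ij jm mj] := intertwined_inv (AI _ _ _ An) mR'.
by rewrite -(pcomp_idp Ij) -kn -pcompA mj (pcomp_idr (AI _ _ _ Ak)).
Qed.

Lemma intertwined_comp P Q R m n :
    m \in intertwined l P Q -> n \in intertwined l Q R ->
  pcomp n m \in intertwined l P R.
Proof.
case: m n => [f a] [g b] /intertwinedP[/= f1 fM fI /subsetP fQ fl].
case/intertwinedP=> /= g1 gM gI /subsetP gR gl.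
have fQ' x : x \in P -> f x \in Q by move=> Px; apply/fQ/imset_f.
have g_1 : g 1 = 1.
  by apply: (mulgI (g 1)); rewrite -gM ?group1 // !mulg1.
apply/intertwinedP; split=> /=.
- by move=> x Px; rewrite ffunE f1.
- by move=> x y Px Py; rewrite !ffunE fM // gM ?fQ'.
- by move=> x y Px Py; rewrite !ffunE => /gI-/(_ (fQ' _ Px) (fQ' _ Py)); apply: fI.
- by apply/subsetP=> _ /imsetP[x Px ->]; rewrite ffunE; apply/gR/imset_f/fQ'.
by move=> x Px; rewrite ffunE conjgM fl // gl ?fQ'.
Qed.

Lemma lact1 : l 1 = 1.
Proof. by apply: (mulgI (l 1)); rewrite -lactM !mulg1. Qed.

Lemma lactV s : l s^-1 = (l s)^-1.
Proof. by apply: (mulgI (l s)); rewrite -lactM mulVg mulgV lact1. Qed.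

Lemma intertwined_conj P Q s :
  s \in transp P Q -> (conjf P s, l s) \in intertwined l P Q.
Proof.
rewrite inE => /subsetP sPQ.
apply/intertwinedP; split=> /=.
- by move=> x /negbTE Px; rewrite ffunE Px.
- by move=> x y Px Py; rewrite !ffunE groupM ?Px ?Py //= !mulgA mulgKV.
- by move=> x y Px Py; rewrite !ffunE Px Py => /mulIg/mulgI.
- apply/subsetP=> _ /imsetP[x Px ->]; rewrite ffunE Px.
  by apply: sPQ; rewrite mem_conjgV conjgE -!mulgA mulVg mulg1 mulKg.
by move=> x Px; rewrite ffunE Px !lactM lactV conjgE.
Qed.

Lemma intertwined_factor P Q (m : pairs gT X) : m \in intertwined l P Q ->
  exists R : {group gT}, m.1 @: P = R /\ m \in intertwined l P R.
Proof.
case/intertwinedP=> m1 mM mI mQ ml.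
have gR : group_set (m.1 @: P).
  apply/group_setP; split=> [|_ _ /imsetP[x Px ->] /imsetP[y Py ->]].
    apply/imsetP; exists 1 => //; apply: (mulgI (m.1 1)).
    by rewrite -mM ?group1 // !mulg1.
  by rewrite -mM // imset_f ?groupM.
by exists (Group gR); split=> //; apply/intertwinedP; split.
Qed.

Variable K : fusion_action_system l -> Prop.

(* The intersection of the systems in K; the intertwining condition only
   matters when K is empty.  It is again a fusion action system because
   factorizations are unique. *)
Definition meet_hom P Q : {set pairs gT X} :=
  [set m in intertwined l P Q | `[< forall A, K A -> m \in A P Q >]].

Lemma meet_homP P Q m : reflect
  (m \in intertwined l P Q /\ forall A, K A -> m \in A P Q) (m \in meet_hom P Q).
Proof.
by apply: (iffP setIdP) => -[Im /asboolP Am].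
Qed.

Fact meet_intertwined P Q : meet_hom P Q \subset intertwined l P Q.
Proof. by apply/subsetP=> m /meet_homP[]. Qed.

Fact meet_comp P Q R m n :
  m \in meet_hom P Q -> n \in meet_hom Q R -> pcomp n m \in meet_hom P R.
Proof.
move=> /meet_homP[Im Am] /meet_homP[In An]; apply/meet_homP.
by split=> [|A KA]; [apply: intertwined_comp Im In | apply: xhom_comp (Am A KA) (An A KA)].
Qed.

Fact meet_conj P Q s : s \in transp P Q -> (conjf P s, l s) \in meet_hom P Q.
Proof.
move=> Ps; apply/meet_homP; split=> [|A _]; [exact: intertwined_conj | exact: xhom_conj].
Qed.

Fact meet_factor P Q m : m \in meet_hom P Q ->
  exists (R : {group gT}) (n : pairs gT X),
    [/\ R \subset Q, xiso meet_hom P R n & m = pcomp (idp X R) n].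
Proof.
case/meet_homP=> Im Am; have [R [mR ImR]] := intertwined_factor Im.
have [Ik km mk] := intertwined_inv ImR mR.
exists R, m; split; last by rewrite (pcomp_idp ImR).
  by rewrite -mR; case/intertwinedP: Im.
split; first by apply/meet_homP; split=> // A /Am /factor_image-/(_ _ mR)[].
exists (invf P m.1, m.2^-1); split=> //.
by apply/meet_homP; split=> // A /Am /factor_image-/(_ _ mR)[].
Qed.

Definition meet_system : fusion_action_system l :=
  FusionActionSystem meet_intertwined meet_comp meet_conj meet_factor.

End Generated.

(* A map theta : Mor(T) -> Sigma_X, that is, a homomorphism from the
   fundamental group of the nerve of T. *)
Record mor_rep p gT (F : fusion_system gT) (T : transporter_system p F)
    (X : finType) := MorRep {
  rep :> forall P Q : objs (ts_ob T), T P Q -> {perm X};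
  repM : forall P Q R (h : T Q R) (g : T P Q),
    rep (comp h g) = rep g * rep h;
  rep_incl : forall (P Q : objs (ts_ob T)) (sPQ : P \subset Q),
    rep (ts_delta T P Q (trans_incl sPQ)) = 1 }.

Section Xtheta.
Variables (p : nat) (gT : finGroupType) (F : fusion_system gT).
Variables (T : transporter_system p F) (X : finType) (theta : mor_rep T X).
Implicit Types P Q : objs (ts_ob T).

Definition ell (s : gT) : {perm X} :=
  let S := ts_top T in theta S S (ts_delta T S S (trans_top s)).

Fact ellM s t : ell (s * t) = ell t * ell s.
Proof.
rewrite /ell -repM -ts_deltaM; congr (theta _ _ (ts_delta T _ _ _)).
exact: val_inj.
Qed.

Definition theta_action : laction gT X := LAction ellM.

Definition contains_theta (A : fusion_action_system theta_action) :=
  forall P Q (g : T P Q), (ts_pi g, theta P Q g) \in A P Q.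

(* The system generated by the (c_g, theta g): see Xtheta_contains, Xtheta_min. *)
Definition Xtheta : fusion_action_system theta_action :=
  meet_system contains_theta.

Lemma theta_intertwined P Q (g : T P Q) :
  (ts_pi g, theta P Q g) \in intertwined theta_action P Q.
Proof.
have thD (R : objs (ts_ob T)) (s : ntrans R R) :
    theta R R (ts_delta T R R s) = ell (val s).
  have sRT : R \subset ts_top T by apply: subsetT.
  have := repM theta (ts_delta T R (ts_top T) (trans_incl sRT)) (ts_delta T R R s).
  rewrite rep_incl mulg1 => <-; rewrite -ts_deltaM.
  rewrite -[ell _]mul1g -(rep_incl theta sRT) -repM -ts_deltaM.
  by congr (theta _ _ (ts_delta T _ _ _)); apply: val_inj; rewrite /= mulg1 mul1g.
rewrite inE (subsetP (fhom_inj F _ _)) ?ts_pi_hom //=; apply/forall_inP=> x Px.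
have PP (R : {group gT}) z : z \in R -> {s : ntrans R R | val s = z}.
  move=> Rz; have Nz : z \in transp R R by rewrite inE conjGid ?groupV.
  by exists (exist _ z Nz).
have Qx : ts_pi g x \in Q.
  have := subsetP (fhom_inj F _ _) _ (ts_pi_hom g).
  by rewrite inE => /and4P[_ _ _ /subsetP]; apply; apply: imset_f.
have [u ux] := PP _ _ Px; have [v vx] := PP _ _ Qx.
rewrite -{}ux in Px vx *; have /(congr1 (theta _ _)) := ts_C Px vx.
by rewrite !repM !thD /= vx => e; rewrite conjgE -e mulKg.
Qed.

Lemma Xtheta_contains : contains_theta Xtheta.
Proof.
move=> P Q g; apply/meet_homP; split; first exact: theta_intertwined.
by move=> A; apply.
Qed.

Lemma Xtheta_min (A : fusion_action_system theta_action) :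
  contains_theta A -> forall R U, Xtheta R U \subset A R U.
Proof. by move=> KA R U; apply/subsetP=> m /meet_homP[_]; apply. Qed.

End Xtheta.

(* Main.v *)
From mathcomp Require Import all_boot all_fingroup all_solvable.
From mathcomp Require Import boolp.
Require Import Defs.

(** Write T(P) for the automorphism group of an object P of the transporter
   system, E(P) for the kernel of its action on P and K(P) for the kernel of
   theta on T(P).  Between objects P, Q the morphisms of the generated system
   are exactly the pairs (c_g, theta g) with g in T(P, Q) (XthetaP): these pairs,
   completed over the subgroups that are not objects, already form a fusion
   action system.  Hence conjugacy of objects is isomorphism in T, and each
   group of automorphisms, pairs or permutations occurring in the axioms is
   the image of T(P), E(P) or K(P) under an evident homomorphism, with the part
   coming from S as the image of its intersection with delta(N_S(P)).

   The key fact (daut_Sylow) is that delta(N_S(P)) is a Sylow subgroup of T(P)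
   as soon as |N_S(P)| is maximal in the conjugacy class of P.  It is proved by
   induction on the index of P: axiom (I) starts the induction, and axioms (II)
   and (C) relate T(P) to T(N_S(P)).

   Now let M(P) be a normal subgroup of T(P) that is preserved by transport
   along isomorphisms: E(P), K(P) or their intersection.  Its intersection with
   delta(N_S(P)) is delta of C_S(P), of N_S(P; X) and of Z_S(P; X),
   respectively.  By the key fact, that intersection is Sylow in M(P) if and only
   if its order is maximal in the conjugacy class (natural_SylowP).  So the four
   notions of being full become Sylow conditions in T(P), E(P), K(P) and their
   intersection; they imply each other because a Sylow subgroup meets a normal
   subgroup in a Sylow subgroup, and the Sylow axioms follow because a
   homomorphism carries Sylow subgroups to Sylow subgroups.

   For the extension axiom, let g : P -> Q be an isomorphism of T representing
   (phi, sigma) and M the intersection of E(Q) and K(Q).  Conjugation by g sends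
   delta(N_(phi, sigma)) into M delta(N_S(Q)), where delta(N_S(Q)) is Sylow when
   Q is fully X-centralized.  Some k in M therefore conjugates the image into
   delta(N_S(Q)); axiom (II) extends k^-1 g, which induces the same pair. *)

Set Implicit Arguments.
Unset Strict Implicit.
Unset Printing Implicit Defensive.

Local Open Scope group_scope.

(** * Homomorphisms and fusion systems *)

Section FusionLemmas.
Variable gT : finGroupType.
Implicit Types (P Q R : {group gT}) (f g : {ffun gT -> gT}) (s : gT).

Lemma InjP P Q f :
  reflect [/\ forall x, x \notin P -> f x = 1, {in P &, {morph f : x y / x * y}},
              {in P &, injective f} & f @: P \subset Q]
          (f \in Inj P Q).
Proof.
rewrite inE; apply: (iffP and4P).
  case=> /forall_inP f1 /morphicP fM /dinjectiveP fI fQ.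
  by split=> // x /f1/eqP.
case=> f1 fM fI fQ; split=> //; first by apply/forall_inP=> x /f1->.
  exact/morphicP.
exact/dinjectiveP.
Qed.

Lemma Inj_mem P Q f x : f \in Inj P Q -> x \in P -> f x \in Q.
Proof. by case/InjP=> _ _ _ /subsetP fQ Px; apply/fQ/imset_f. Qed.

Lemma Inj_ext P Q f g : f \in Inj P Q -> g \in Inj P Q ->
  {in P, f =1 g} -> f = g.
Proof.
case/InjP=> f1 _ _ _ /InjP[g1 _ _ _] fg; apply/ffunP=> x.
by have [/fg //|Px] := boolP (x \in P); rewrite f1 ?g1.
Qed.

Lemma transpN P s : (s \in transp P P) = (s \in 'N(P)).
Proof. by rewrite inE -groupV inE. Qed.

Lemma norm_conjV P s x : s \in 'N(P) -> (s * x * s^-1 \in P) = (x \in P).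
Proof.
rewrite -groupV => /(memJ_norm x).
by rewrite conjgE invgK mulgA.
Qed.

Lemma normVP P s :
  reflect {in P, forall x, s * x * s^-1 \in P} (s \in 'N(P)).
Proof.
apply: (iffP idP) => [Ns x Px | nPs]; first by rewrite norm_conjV.
rewrite -groupV inE; apply/subsetP=> _ /imsetP[x Px ->].
by rewrite conjgE invgK mulgA nPs.
Qed.

Lemma conjf1 P : conjf P 1 = idf P.
Proof. by apply/ffunP=> x; rewrite !ffunE mul1g invg1 mulg1. Qed.

Lemma fcomp_idl P Q f : f \in Inj P Q -> fcomp (idf Q) f = f.
Proof.
move=> If; apply/ffunP=> x; rewrite !ffunE; case: ifP => // /negP Qfx.
have [/(Inj_mem If) // | Px] := boolP (x \in P).
by case/InjP: If => ->.
Qed.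

Lemma Inj_one P Q f : f \in Inj P Q -> f 1 = 1.
Proof. by case/InjP=> _ fM _ _; apply: (mulgI (f 1)); rewrite -fM ?mulg1. Qed.

Lemma fcomp_idr P Q f : f \in Inj P Q -> fcomp f (idf P) = f.
Proof.
move=> If; apply/ffunP=> x; rewrite !ffunE; case: ifP => // /negbT Px.
by rewrite (Inj_one If); case/InjP: If => ->.
Qed.

Lemma InjV P Q f x : f \in Inj P Q -> x \in P -> f x^-1 = (f x)^-1.
Proof.
move=> If Px; apply: (mulgI (f x)); case/InjP: (If) => _ fM _ _.
by rewrite -fM ?groupV // !mulgV (Inj_one If).
Qed.

Lemma InjJ P Q f x y : f \in Inj P Q -> x \in P -> y \in P ->
  f (y * x * y^-1) = f y * f x * (f y)^-1.
Proof.
move=> If Px Py; case/InjP: (If) => _ fM _ _.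
by rewrite !fM ?groupM ?groupV // (InjV If).
Qed.

Variable F : fusion_system gT.

Lemma fhomI P Q f : f \in F P Q -> f \in Inj P Q.
Proof. exact/subsetP/fhom_inj. Qed.

Lemma fhom_incl P Q : P \subset Q -> idf P \in F P Q.
Proof. by move=> sPQ; rewrite -conjf1 fhom_conj ?transp1. Qed.

(** Injectivity and finiteness identify the image of [f] with the subgroup
   through which [f] factors. *)
Lemma fhom_image P Q f : f \in F P Q ->
  exists R : {group gT}, [/\ R = f @: P :> {set gT}, R \subset Q & fiso F P R f].
Proof.
move=> Ff; have [R [f0 [sRQ isof def_f]]] := fhom_factor Ff.
have [Ff0 [h [Fh hf fh]]] := isof.
have eff0: f = f0 by rewrite def_f (fcomp_idl (fhomI Ff0)).
rewrite eff0; exists R; split=> //; apply/eqP; rewrite eqEsubset andbC.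
case/InjP: (fhomI Ff0) => _ _ _ -> /=; apply/subsetP=> y Ry.
apply/imsetP; exists (h y); first exact: (Inj_mem (fhomI Fh)).
by move/ffunP/(_ y): fh; rewrite !ffunE Ry.
Qed.

Lemma fhom_codom P Q R f : f \in F P Q -> f @: P \subset R -> f \in F P R.
Proof.
case/fhom_image=> R1 [eR1 _ [Ff _]] sfR.
rewrite -(fcomp_idl (fhomI Ff)).
by apply: fhom_comp Ff _; rewrite fhom_incl // eR1.
Qed.

End FusionLemmas.

(** * Morphisms of a transporter system *)

Section Transporter.
Variables (p : nat) (gT : finGroupType) (F : fusion_system gT).
Variable T : transporter_system p F.
Implicit Types P Q R : objs (ts_ob T).

Definition inc P Q (sPQ : P \subset Q) : T P Q :=
  ts_delta T P Q (trans_incl sPQ).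

Lemma ts_pi_Inj P Q (g : T P Q) : ts_pi g \in Inj P Q.
Proof. exact/fhomI/ts_pi_hom. Qed.

Lemma ts_pi_mem P Q (g : T P Q) x : x \in P -> ts_pi g x \in Q.
Proof. exact: Inj_mem (ts_pi_Inj g). Qed.

Lemma ts_pi_inc P Q (sPQ : P \subset Q) : ts_pi (inc sPQ) = idf P.
Proof. by rewrite ts_pi_delta conjf1. Qed.

Lemma objs_over P (R : {group gT}) : P \subset R ->
  exists R' : objs (ts_ob T), val R' = R.
Proof.
move=> sPR; have HR : R \in ts_ob T.
  by case: (ts_ob_closed T) => _ /(_ (val P) R (valP P)); apply.
by exists (exist _ R HR).
Qed.

(** As [ts_pi g] is injective, [a] and [b] have the same image under pi, so they
   differ by an element of E(P), which is trivial because E(P) acts freely on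
   T(P, R). *)
Lemma comp_monic P Q R (g : T Q R) (a b : T P Q) :
  comp g a = comp g b -> a = b.
Proof.
move=> gab; have piab: ts_pi a = ts_pi b.
  apply: Inj_ext (ts_pi_Inj a) (ts_pi_Inj b) _ => x Px.
  case/InjP: (ts_pi_Inj g) => _ _ gI _; apply: gI; try exact: ts_pi_mem.
  move/(congr1 (@ts_pi _ _ _ _ _ _)): gab.
  by rewrite !ts_piM => /ffunP/(_ x); rewrite !ffunE.
have [e pie eb] := (ts_pi_orbit a b).1 piab.
rewrite eb; rewrite eb compA in gab.
by rewrite (ts_free_r pie (esym gab)) compm1.
Qed.

Lemma ker_right_inv P (e : T P P) : ts_pi e = idf P ->
  exists2 e' : T P P, ts_pi e' = idf P & comp e e' = idm T P.
Proof.
move=> pie; have : ts_pi e = ts_pi (idm T P) by rewrite ts_pi1.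
by case/ts_pi_orbit=> e' ? ?; exists e'.
Qed.

(** The elements of E(P) have right inverses in E(P), and a monoid in which every
   element has a right inverse is a group. *)
Lemma ker_inv P (e : T P P) : ts_pi e = idf P ->
  exists e' : T P P, comp e e' = idm T P /\ comp e' e = idm T P.
Proof.
case/ker_right_inv=> e' pie' ee'; have [e'' _ e'e''] := ker_right_inv pie'.
exists e'; split=> //; suff -> : e = e'' by [].
by rewrite -(compm1 e) -e'e'' compA ee' comp1m.
Qed.

Definition tinv P Q (g : T P Q) (h : T Q P) :=
  comp h g = idm T P /\ comp g h = idm T Q.

Lemma tinv_sym P Q (g : T P Q) h : tinv g h -> tinv h g.
Proof. by case. Qed.

Lemma tinv_comp P Q R (g : T P Q) h (g' : T Q R) h' :
  tinv g h -> tinv g' h' -> tinv (comp g' g) (comp h h').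
Proof.
case=> hg gh [hg' gh']; split.
  by rewrite -compA (compA h') hg' comp1m.
by rewrite -compA (compA g) gh comp1m.
Qed.

(** A lift of the inverse of [ts_pi g] is an inverse of [g] up to elements of
   E(P) and E(Q), and these are invertible. *)
Lemma ts_iso P Q (g : T P Q) : fiso F P Q (ts_pi g) -> exists h, tinv g h.
Proof.
case=> _ [f [Ff fg gf]]; have [h pih] := ts_pi_surj Ff.
have [e [_ eV]]: exists e' : T P P,
    comp (comp h g) e' = idm T P /\ comp e' (comp h g) = idm T P.
  by apply: ker_inv; rewrite ts_piM pih.
have [e' [eV' _]]: exists e' : T Q Q,
    comp (comp g h) e' = idm T Q /\ comp e' (comp g h) = idm T Q.
  by apply: ker_inv; rewrite ts_piM pih.
exists (comp e h); split; first by rewrite -compA.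
suff -> : comp e h = comp h e' by rewrite compA.
by rewrite -[comp e h]compm1 -eV' !compA -(compA e) eV comp1m.
Qed.

Lemma ts_iso_card P Q (g : T P Q) : #|P| = #|Q| -> exists h, tinv g h.
Proof.
move=> cPQ; apply: ts_iso; have [R [eR sRQ isoR]] := fhom_image (ts_pi_hom g).
suff <- : R = Q by [].
have eRQ : R :=: Q.
  case/InjP: (ts_pi_Inj g) => _ _ gI _; apply/eqP.
  by rewrite eqEcard sRQ eR card_in_imset //= -cPQ.
exact/val_inj.
Qed.

Lemma tinv_card P Q (g : T P Q) h : tinv g h -> #|P| = #|Q|.
Proof.
have le A B (k : T A B) : #|A| <= #|B|.
  case/InjP: (ts_pi_Inj k) => _ _ kI sk.
  by rewrite -(card_in_imset kI) subset_leq_card.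
by move=> _; apply/eqP; rewrite eqn_leq !le.
Qed.

(** A lift to T of the corestriction of [ts_pi g] is right up to an element of
   E(P), which is absorbed in the lift. *)
Lemma ts_codom P Q R (g : T P Q) (sRQ : R \subset Q) :
  ts_pi g @: P \subset R -> exists g0 : T P R, g = comp (inc sRQ) g0.
Proof.
move=> sgR; have [g0 pig0] := ts_pi_surj (fhom_codom (ts_pi_hom g) sgR).
have : ts_pi (comp (inc sRQ) g0) = ts_pi g.
  rewrite ts_piM ts_pi_inc -pig0.
  exact: (fcomp_idl (ts_pi_Inj g0)).
by case/ts_pi_orbit=> e _ ->; exists (comp g0 e); rewrite compA.
Qed.

Lemma ts_image P Q (g : T P Q) :
  exists R, exists (sRQ : R \subset Q) (g0 : T P R) (h0 : T R P),
    [/\ R = ts_pi g @: P :> {set gT}, tinv g0 h0 & g = comp (inc sRQ) g0].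
Proof.
have [R0 [eR0 sRQ isoR]] := fhom_image (ts_pi_hom g).
have HR : R0 \in ts_ob T.
  case: (ts_ob_closed T) => /(_ (val P) R0 (valP P)) + _; apply.
  by exists (ts_pi g).
pose R : objs (ts_ob T) := exist _ R0 HR.
have [|g0 eg0] := @ts_codom P Q R g sRQ; first by rewrite -eR0.
have [|h0 g0h0] := @ts_iso_card P R g0.
  by rewrite [#|R|]/= eR0 card_in_imset //; case/InjP: (ts_pi_Inj g).
by exists R, sRQ, g0, h0.
Qed.

(** ** Automorphism groups *)

Lemma aut_mor_inj P : injective (@aut_mor _ T P).
Proof.
move=> u v uv; apply: val_inj; move: uv; rewrite /aut_mor.
case: u v => -[a a'] /= ua [[b b'] /= vb] /= ab.
case/andP: ua => _ /eqP a'a; case/andP: vb => /eqP bb' _.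
by rewrite -ab in bb' *; rewrite -[b']comp1m -a'a -compA bb' compm1.
Qed.

Lemma aut_morM P (u v : cat_aut T P) :
  aut_mor (u * v) = comp (aut_mor u) (aut_mor v).
Proof. by []. Qed.

Lemma aut_mor1 P : aut_mor (1 : cat_aut T P) = idm T P.
Proof. by []. Qed.

Lemma aut_morX P (u : cat_aut T P) n :
  aut_mor (u ^+ n.+1) = comp (aut_mor u) (aut_mor (u ^+ n)).
Proof. by rewrite expgS. Qed.

Lemma aut_morVK P (u : cat_aut T P) : tinv (aut_mor u) (aut_mor u^-1).
Proof. by split; rewrite -aut_morM ?mulVg ?mulgV. Qed.

Lemma aut_of_mor P (g : T P P) : exists u : cat_aut T P, aut_mor u = g.
Proof.
have [h [hg gh]] := @ts_iso_card P P g erefl.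
have gP : (comp g h == idm T P) && (comp h g == idm T P) by rewrite gh hg !eqxx.
by exists (exist _ (g, h) gP).
Qed.

Definition aut_of P (g : T P P) : cat_aut T P :=
  odflt 1 [pick u : cat_aut T P | aut_mor u == g].

Lemma aut_ofK P (g : T P P) : aut_mor (aut_of g) = g.
Proof.
rewrite /aut_of; case: pickP => [v /eqP // | none].
by have [v ev] := aut_of_mor g; have := none v; rewrite ev eqxx.
Qed.

(** The morphism delta(s) for s in N_S(P), made total in s so that delta on
   automorphisms becomes a group morphism with domain 'N(P). *)
Definition dmor P s : T P P :=
  if insub s is Some u then ts_delta T P P u else idm T P.

Lemma dmorE P (u : ntrans P P) : dmor P (val u) = ts_delta T P P u.
Proof. by rewrite /dmor valK. Qed.

Lemma dmorP P s : s \in 'N(P) ->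
  exists2 u : ntrans P P, val u = s & dmor P s = ts_delta T P P u.
Proof.
rewrite -transpN => Ns; pose u : ntrans P P := exist _ s Ns.
by exists u => //; rewrite -dmorE.
Qed.

Lemma dmorM P s t : s \in 'N(P) -> t \in 'N(P) ->
  dmor P (s * t) = comp (dmor P s) (dmor P t).
Proof.
case/dmorP=> u <- ->; case/dmorP=> v <- ->.
rewrite -ts_deltaM -dmorE; congr (dmor P _).
Qed.

Definition daut P (s : gT) : cat_aut T P := aut_of (dmor P s).

Lemma dautM P : {in 'N(P) &, {morph daut P : s t / s * t}}.
Proof.
move=> s t Ns Nt; apply: aut_mor_inj.
by rewrite aut_morM !aut_ofK dmorM.
Qed.
Canonical daut_morphism P := Morphism (@dautM P).

Lemma injm_daut P : 'injm (daut P).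
Proof.
apply/injmP=> s t Ns Nt /(congr1 (@aut_mor _ _ _)); rewrite !aut_ofK.
by case/dmorP: Ns => u <- ->; case/dmorP: Nt => v <- -> /ts_delta_inj->.
Qed.

Lemma ts_pi_dmor P s : s \in 'N(P) -> ts_pi (dmor P s) = conjf P s.
Proof. by case/dmorP=> u <- ->; rewrite ts_pi_delta. Qed.

Lemma dmor_inc P Q (sPQ : P \subset Q) s : s \in 'N(P) -> s \in 'N(Q) ->
  comp (dmor Q s) (inc sPQ) = comp (inc sPQ) (dmor P s).
Proof.
case/dmorP=> u us -> /dmorP[v vs ->]; rewrite /inc -!ts_deltaM.
congr (ts_delta T P Q _).
by apply: val_inj; rewrite /= [sval u]us [sval v]vs mulg1 mul1g.
Qed.

Lemma dmor_C P Q (g : T P Q) x : x \in P ->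
  comp (dmor Q (ts_pi g x)) g = comp g (dmor P x).
Proof.
move=> Px; have Nx := subsetP (normG _) _ Px.
have Ngx := subsetP (normG _) _ (ts_pi_mem g Px).
case/dmorP: Nx => u ux ->; case/dmorP: Ngx => v vx ->.
by apply: ts_C; rewrite ux.
Qed.

Definition autJ P Q (g : T P Q) (h : T Q P) (u : cat_aut T P) : cat_aut T Q :=
  aut_of (comp g (comp (aut_mor u) h)).

Lemma autJM P Q (g : T P Q) h : tinv g h ->
  {in [set: cat_aut T P] &, {morph autJ g h : u v / u * v}}.
Proof.
case=> hg _ u v _ _; apply: aut_mor_inj.
rewrite aut_morM !aut_ofK aut_morM.
by rewrite -!compA (compA h) hg comp1m.
Qed.

Lemma autJ_inj P Q (g : T P Q) h : tinv g h -> injective (autJ g h).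
Proof.
case=> hg gh u v /(congr1 (@aut_mor _ _ _)); rewrite !aut_ofK => /comp_monic e.
apply: aut_mor_inj; move/(congr1 (fun k => comp k g)): e.
by rewrite -!compA hg !compm1.
Qed.

(** ** Conjugacy classes of objects *)

Definition tiso P Q := exists g : T P Q, exists h, tinv g h.

Lemma tiso_refl P : tiso P P.
Proof. by exists (idm T P), (idm T P); split; rewrite comp1m. Qed.

Lemma tiso_sym P Q : tiso P Q -> tiso Q P.
Proof. by case=> g [h /tinv_sym]; exists h, g. Qed.

Lemma tiso_trans P Q R : tiso P Q -> tiso Q R -> tiso P R.
Proof.
case=> g [h gh] [g' [h' gh']].
by exists (comp g' g), (comp h h'); apply: tinv_comp.
Qed.

Definition tmax (m : {group gT} -> nat) P :=
  forall Q, tiso P Q -> m Q <= m P.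

Lemma tmax_exists (m : {group gT} -> nat) P : exists2 Q, tiso P Q & tmax m Q.
Proof.
have P0 : `[< tiso P P >] by apply/asboolP/tiso_refl.
pose I : finType := {Q : {group gT} | Q \in ts_ob T}.
have := @arg_maxnP I P (fun Q : I => `[< tiso P Q >]) (fun Q : I => m (val Q)) P0.
case=> Q /asboolP isoQ maxQ; exists Q => // R isoR.
by apply: (maxQ R); apply/asboolP; apply: tiso_trans isoQ isoR.
Qed.

(** ** Sylow subgroups of automorphism groups *)

Hypothesis pS : p.-group [set: gT].

Lemma pgroup_all (H : {group gT}) : p.-group H.
Proof. exact: pgroupS (subsetT H) pS. Qed.

Lemma pgroup_daut P (H : {group gT}) : p.-group (daut P @* H).
Proof. by rewrite morphim_pgroup ?pgroup_all. Qed.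

Lemma daut_top_Sylow :
  p.-Sylow([set: cat_aut T (ts_top T)]) (daut (ts_top T) @* 'N(ts_top T)).
Proof.
have nS s : s \in 'N(ts_top T) by rewrite -transpN transpT.
rewrite (_ : _ @* _ = [set u | [exists s : gT,
   aut_mor u == @ts_delta _ _ _ T (ts_top T) (ts_top T) (trans_top s)]]).
  exact: ts_Sylow.
have eD s : aut_mor (daut (ts_top T) s) =
    @ts_delta _ _ _ T (ts_top T) (ts_top T) (trans_top s).
  by rewrite aut_ofK -dmorE.
apply/setP=> u; rewrite inE; apply/morphimP/existsP=> [[s _ _ ->] | [s /eqP us]].
  by exists s; rewrite /= eD.
by exists s => //; apply: aut_mor_inj; rewrite us eD.
Qed.

Definition restr P Q (sPQ : P \subset Q) (v : cat_aut T Q) (u : cat_aut T P) :=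
  comp (aut_mor v) (inc sPQ) = comp (inc sPQ) (aut_mor u).

Lemma restrX P Q (sPQ : P \subset Q) v u n :
  restr sPQ v u -> restr sPQ (v ^+ n) (u ^+ n).
Proof.
rewrite /restr => vu; elim: n => [|n IHn]; first by rewrite !aut_mor1 comp1m compm1.
by rewrite !aut_morX -compA IHn !compA vu.
Qed.

(** Axiom (II) for an automorphism normalizing the image of the overgroup. *)
Lemma ts_extend_aut P (N : objs (ts_ob T)) (nPN : P <| N) (u : cat_aut T P) :
    u \in 'N(daut P @* (N : {group gT})) -> exists v, restr (normal_sub nPN) v u.
Proof.
move=> Nu; have [uV Vu] := aut_morVK u.
have sNN := normal_norm nPN.
have [|g' eg'] := ts_extend nPN nPN uV Vu.
  move=> s Ns; have: daut P (val s) ^ u^-1 \in daut P @* (N : {group gT}).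
    by rewrite memJ_norm ?groupV // mem_morphim // (subsetP sNN).
  case/morphimP=> t Nt N't et; have [v vt dv] := dmorP Nt.
  exists v; first by rewrite vt.
  rewrite -dv -(aut_ofK (dmor P t)) -[aut_of _]et conjgE invgK !aut_morM.
  by rewrite aut_ofK dmorE compA.
by exists (aut_of g'); rewrite /restr aut_ofK.
Qed.

(** The inductive step of [daut_Sylow].  After transport to a conjugate N' of N = N_S(P), Sylow's
   theorem turns the p-element w into delta(s) with s in N_S(N').  The image P'
   of P is invariant under s and under N', so maximality of |N_S(P)| forces
   N_S(P') = N', which puts s in N'; axiom (C) then pulls delta(s) back to an
   element of delta(N). *)
Lemma sylow_step P (N N' : objs (ts_ob T)) (w : cat_aut T N) (u : cat_aut T P)
    (sPN : P \subset N) :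
    N = 'N(P) :> {set gT} -> tmax (fun H : {group gT} => #|'N(H)|) P -> tiso N N' ->
    p.-Sylow([set: cat_aut T N']) (daut N' @* 'N(N')) ->
  restr sPN w u -> p.-elt w -> u \in daut P @* 'N(P).
Proof.
move=> eN maxP [g [h gh]] sylN' wu pw.
have [|t _] := Sylow_subJ sylN' (subsetT <[autJ g h w]>).
  exact: (morph_p_elt (Morphism (autJM gh)) (in_setT w) pw).
rewrite cycle_subG => /imsetP[_ /morphimP[s Ns _ ->] ew].
pose h' := comp (aut_mor t) g.
have h'iso := tinv_comp gh (aut_morVK t); rewrite -/h' in h'iso.
have h'w : comp h' (aut_mor w) = comp (dmor N' s) h'.
  have [hg _] := gh; have [tV Vt] := aut_morVK t.
  have := congr1 (@aut_mor _ _ _) ew; rewrite conjgE !aut_morM !aut_ofK.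
  move/(congr1 (fun k => comp (comp (aut_mor t) k) g)).
  rewrite -!compA hg compm1 /h' => ->.
  by rewrite !compA Vt comp1m.
clearbody h'.
have [P' [sP'N' [k [l [eP' kl eh']]]]] := ts_image (comp h' (inc sPN)).
have pih' y : y \in P -> ts_pi h' y = ts_pi k y.
  move=> Py; have := congr1 (@ts_pi _ _ _ _ _ _) eh'; rewrite !ts_piM !ts_pi_inc.
  by rewrite (fcomp_idl (ts_pi_Inj k)) => /ffunP/(_ y); rewrite !ffunE Py.
have memP' y : y \in P -> ts_pi h' y \in P' by move=> Py; rewrite pih' ?ts_pi_mem.
have inP' y : y \in P' -> exists2 x, x \in P & y = ts_pi h' x.
  rewrite -[_ \in _]/(y \in (P' : {set gT})) eP' => /imsetP[x Px ->]; exists x => //.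
  by rewrite ts_piM ts_pi_inc !ffunE Px.
have N'h' y : y \in N' -> exists2 n, n \in N & y = ts_pi h' n.
  move=> N'y; exists (ts_pi (comp h (aut_mor t^-1)) y); first exact: ts_pi_mem.
  case: h'iso => _ /(congr1 (@ts_pi _ _ _ _ _ _)); rewrite ts_piM ts_pi1.
  by move/ffunP/(_ y)/esym; rewrite !ffunE N'y.
have subN' : N' \subset 'N(P').
  apply/subsetP=> _ /N'h'[n Nn ->].
  apply/normVP=> _ /inP'[x Px ->].
  rewrite -(InjJ (ts_pi_Inj h')) // ?(subsetP sPN) //.
  by apply: memP'; rewrite norm_conjV // -eN.
have eN' : 'N(P') = N'.
  apply/eqP; rewrite eq_sym eqEcard subN' /=.
  rewrite -(tinv_card gh) [#|N|]/= eN.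
  by apply: (maxP P'); exists k, l.
have Ns' : s \in N'.
  rewrite -[s \in _]/(s \in (N' : {set gT})) -eN'; apply/normVP=> _ /inP'[x Px ->].
  have N'x : ts_pi h' x \in N' by apply: ts_pi_mem; apply: (subsetP sPN).
  have -> : s * ts_pi h' x * s^-1 = ts_pi h' (ts_pi (aut_mor u) x).
    have := congr1 (fun k => ts_pi (comp k (inc sPN))) h'w.
    rewrite -compA wu !ts_piM ts_pi_inc ts_pi_dmor //.
    by move/ffunP/(_ x); rewrite !ffunE Px N'x ts_pi_mem.
  by apply: memP'; apply: ts_pi_mem.
have [n Nn es] := N'h' s Ns'.
rewrite es (dmor_C h' Nn) in h'w; move/comp_monic: h'w => ewn.
have NPn : n \in 'N(P) by rewrite -eN.
have NNn : n \in 'N(N) by rewrite (subsetP (normG N)).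
move: wu; rewrite /restr ewn (dmor_inc sPN NPn NNn) => /comp_monic eu.
by apply/morphimP; exists n => //; apply: aut_mor_inj; rewrite aut_ofK.
Qed.

(** If a Sylow subgroup R containing D = delta(N_S(P)) were larger than D, then
   D would be properly contained in its normalizer in R.  An element u of that
   normalizer extends to N = N_S(P) by axiom (II), and [sylow_step] applies to
   the extension, whose Sylow hypothesis holds by induction since |N| > |P|. *)
Lemma daut_Sylow P : tmax (fun H : {group gT} => #|'N(H)|) P ->
  p.-Sylow([set: cat_aut T P]) (daut P @* 'N(P)).
Proof.
have [n] := ubnP (#|[set: gT]| - #|P|); elim: n P => // n IHn P ltPn maxP.
have [eP | ltPT] := eqVproper (subsetT P).
  by have -> : P = ts_top T by [apply/val_inj/val_inj]; apply: daut_top_Sylow.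
have [N eN] : exists N : objs (ts_ob T), val N = 'N(P)%G.
  exact: (objs_over (normG P)).
have eN' : N = 'N(P) :> {set gT} by rewrite -[N : {set gT}]/(val N : {set gT}) eN.
have nPN : P <| N by rewrite /normal eN' normG subxx.
have ltPN : #|P| < #|N|.
  have := nilpotent_proper_norm (pgroup_nil pS) ltPT.
  by rewrite setTI -eN' => /proper_card.
have [N' isoN maxN'] := tmax_exists (fun H : {group gT} => #|'N(H)|) N.
have sylN' : p.-Sylow([set: cat_aut T N']) (daut N' @* 'N(N')).
  apply: IHn maxN'; have [g [h gh]] := isoN.
  rewrite -(tinv_card gh); apply: leq_trans (ltPn : _ <= n); rewrite ltn_sub2l //.
  by apply: proper_card.
have [R sylR sDR] := Sylow_superset (subsetT (daut P @* 'N(P))) (pgroup_daut P _).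
suff <- : R :=: daut P @* 'N(P) by [].
apply: nilpotent_sub_norm => //; first exact: pgroup_nil (pHall_pgroup sylR).
apply/subsetP=> u /setIP[Ru Nu].
have [|v vu] := @ts_extend_aut P N nPN u; first by rewrite eN'.
(* The extension v need not be a p-element, but its power v ^+ m is, and u ^+ m
   still generates <[u]> because u is a p-element. *)
set m := (#[v]`_p^')%N.
suff um : u ^+ m \in daut P @* 'N(P).
  have pu : p.-elt u := mem_p_elt (pHall_pgroup sylR) Ru.
  rewrite -cycle_subG (_ : <[u]> = <[u ^+ m]>) ?cycle_subG //.
  apply/eqP; rewrite -[_ == _]/(generator _ _) generator_coprime.
  by rewrite (pnat_coprime pu) ?part_pnat.
apply: (sylow_step eN' maxP isoN sylN' (restrX m vu)).
rewrite /p_elt orderXdiv ?dvdn_part // -(partnC p (order_gt0 v)).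
by rewrite mulnK ?part_gt0 ?part_pnat.
Qed.

(** ** Natural families of subgroups of the automorphism groups *)

Definition natural_family (M : forall P, {group cat_aut T P}) :=
  forall P Q (g : T P Q) h u, tinv g h -> u \in M P -> autJ g h u \in M Q.

Section Family.
Variable M : forall P, {group cat_aut T P}.
Hypothesis natM : natural_family M.

Lemma natural_normal P : M P <| [set: cat_aut T P].
Proof.
rewrite /normal subsetT; apply/subsetP=> t _; rewrite -groupV inE.
apply/subsetP=> _ /imsetP[u Mu ->].
have -> : u ^ t^-1 = autJ (aut_mor t) (aut_mor t^-1) u.
  by apply: aut_mor_inj; rewrite aut_ofK conjgE invgK !aut_morM compA.
exact: natM (aut_morVK t) Mu.
Qed.

Lemma natural_card P Q : tiso P Q -> #|M P| = #|M Q|.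
Proof.
have le A B : tiso A B -> #|M A| <= #|M B|.
  case=> g [h gh]; rewrite -(card_imset _ (autJ_inj gh)) subset_leq_card //.
  by apply/subsetP=> _ /imsetP[u Mu ->]; apply: natM.
by move=> PQ; apply/eqP; rewrite eqn_leq !le //; apply: tiso_sym.
Qed.

Lemma card_daut_meet P :
  #|daut P @* 'N(P) :&: M P| = #|daut P @*^-1 M P|.
Proof.
rewrite -(card_injm (injm_daut P)) ?subsetIl //.
by rewrite -morphpreIim morphpreK ?subsetIl.
Qed.

Lemma pgroup_daut_meet P : p.-group (daut P @* 'N(P) :&: M P).
Proof. exact: pgroupS (subsetIl _ _) (pgroup_daut P _). Qed.

(** Sylow subgroups of the isomorphic groups [M Q] have the same order, which
   bounds the order of the part of [M Q] coming from S; for a fully normalized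
   conjugate the bound is attained since [M Q] is normal. *)
Lemma natural_SylowP (m : {group gT} -> nat) P :
    (forall Q, m Q = #|daut Q @*^-1 M Q|) ->
  tmax m P <-> p.-Sylow(M P) (daut P @* 'N(P) :&: M P).
Proof.
move=> mE; rewrite pHallE subsetIr /= card_daut_meet -mE.
have le_m Q : m Q <= #|M Q|`_p.
  rewrite mE -card_daut_meet dvdn_leq // -(part_pnat_id (pgroup_daut_meet Q)).
  by rewrite partn_dvd // cardSg // subsetIr.
split=> [maxP | /eqP eP Q isoQ]; last first.
  by rewrite eP (natural_card isoQ).
rewrite eqn_leq le_m /=.
have [Q isoQ maxQ] := tmax_exists (fun H : {group gT} => #|'N(H)|) P.
apply: leq_trans (maxP Q isoQ); rewrite mE -card_daut_meet (natural_card isoQ).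
rewrite setIC.
by rewrite -(card_Hall (Sylow_setI_normal (natural_normal Q) (daut_Sylow maxQ))).
Qed.

End Family.

(** [M2 P] is normal in [M1 P], and a Sylow subgroup meets a normal subgroup in
   a Sylow subgroup. *)
Lemma natural_Sylow_sub M1 M2 P :
    natural_family M1 -> natural_family M2 -> M2 P \subset M1 P ->
    p.-Sylow(M1 P) (daut P @* 'N(P) :&: M1 P) ->
  p.-Sylow(M2 P) (daut P @* 'N(P) :&: M2 P).
Proof.
move=> nat1 nat2 s21 syl1.
have n21 : M2 P <| M1 P by apply: normalS s21 (subsetT _) (natural_normal nat2 P).
have := Sylow_setI_normal n21 syl1.
by rewrite setIC -setIA (setIidPr s21).
Qed.

Lemma natural_setT : natural_family (fun P => [set: cat_aut T P]%G).
Proof. by move=> P Q g h u _ _; rewrite inE. Qed.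

Lemma natural_setI M1 M2 : natural_family M1 -> natural_family M2 ->
  natural_family (fun P => (M1 P :&: M2 P)%G).
Proof.
move=> nat1 nat2 P Q g h u gh /setIP[M1u M2u].
by rewrite inE nat1 ?nat2.
Qed.

(** ** The kernel E(P) *)

Lemma ts_pi_autM P (u v : cat_aut T P) :
  ts_pi (aut_mor (u * v)) = fcomp (ts_pi (aut_mor u)) (ts_pi (aut_mor v)).
Proof. by rewrite aut_morM ts_piM. Qed.

Fact pi_ker_group_set P :
  group_set [set u : cat_aut T P | ts_pi (aut_mor u) == idf P].
Proof.
apply/group_setP; split=> [|u v]; first by rewrite inE aut_mor1 ts_pi1.
rewrite !inE ts_pi_autM => /eqP-> /eqP->; apply/eqP.
exact: fcomp_idl (fhomI (fhom_incl F (subxx P))).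
Qed.
Canonical pi_ker P := Group (pi_ker_group_set P).

Lemma pi_kerE P (u : cat_aut T P) :
  (u \in pi_ker P) = (ts_pi (aut_mor u) == idf P).
Proof. by rewrite inE. Qed.

Lemma natural_pi_ker : natural_family pi_ker.
Proof.
move=> P Q g h u [hg gh]; rewrite !pi_kerE aut_ofK => /eqP piu.
by rewrite !ts_piM piu (fcomp_idl (ts_pi_Inj h)) -ts_piM gh ts_pi1.
Qed.

Lemma conjf_id P s : s \in 'N(P) -> (conjf P s == idf P) = (s \in 'C(P)).
Proof.
move=> Ns; apply/eqP/centP=> [sP x Px | cPs].
  move/ffunP/(_ x): sP; rewrite !ffunE Px => /(congr1 (mulg^~ s)).
  by rewrite mulgKV.
by apply/ffunP=> x; rewrite !ffunE; case: ifP => // Px; rewrite (cPs x Px) mulgK.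
Qed.

Lemma daut_pre_pi_ker P : daut P @*^-1 pi_ker P = 'C(P).
Proof.
apply/setP=> s; apply/morphpreP/idP=> [[Ns] | cPs].
  by rewrite pi_kerE aut_ofK ts_pi_dmor ?conjf_id.
have Ns := subsetP (cent_sub _) _ cPs.
by rewrite pi_kerE aut_ofK ts_pi_dmor ?conjf_id.
Qed.

(** ** The action of automorphisms on the underlying subgroup *)

(** The permutations of the library compose in the opposite order to T(P), so the
   inverse is taken to obtain a morphism; images of subgroups are unaffected.
   [rep_aut] below does the same for theta. *)
Definition aut_perm P (u : cat_aut T P) : {perm gT} :=
  odflt 1 [pick a in Aut P | resf P a == ts_pi (aut_mor u^-1)].

Lemma Inj_Aut P (f : {ffun gT -> gT}) : f \in Inj P P ->
  exists2 a, a \in Aut P & resf P a = f.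
Proof.
case/InjP=> f1 fM fI fP.
exists (perm_in fI fP); last first.
  apply/ffunP=> x; rewrite ffunE; case: ifP => [Px | /negbT /f1-> //].
  by rewrite perm_inE.
rewrite inE perm_in_on; apply/morphicP=> x y Px Py.
by rewrite !perm_inE ?groupM // fM.
Qed.

Lemma resf_Aut_inj P (a b : {perm gT}) :
  a \in Aut P -> b \in Aut P -> resf P a = resf P b -> a = b.
Proof.
move=> Aa Ab /ffunP ab; apply: eq_Aut Aa Ab _ => x Px.
by move: (ab x); rewrite !ffunE Px.
Qed.

Lemma aut_permP P (u : cat_aut T P) :
  aut_perm u \in Aut P /\ resf P (aut_perm u) = ts_pi (aut_mor u^-1).
Proof.
rewrite /aut_perm; case: pickP => [a /andP[Aa /eqP] // | none].
have [a Aa ra] := Inj_Aut (ts_pi_Inj (aut_mor u^-1)).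
by have := none a; rewrite [_ \in _]Aa ra eqxx.
Qed.

Lemma aut_permM P : {in [set: cat_aut T P] &, {morph @aut_perm P : u v / u * v}}.
Proof.
move=> u v _ _; have [Au ru] := aut_permP u; have [Av rv] := aut_permP v.
have [Auv ruv] := aut_permP (u * v).
apply: (resf_Aut_inj Auv); first exact: groupM.
rewrite ruv invMg ts_pi_autM -ru -rv; apply/ffunP=> x; rewrite !ffunE.
have [Px | Px] := boolP (x \in P); first by rewrite Aut_closed // permM.
have : resf P (aut_perm v) 1 = 1 by rewrite rv (Inj_one (ts_pi_Inj _)).
by rewrite ffunE => ->.
Qed.
Canonical aut_perm_morphism P := Morphism (@aut_permM P).

Lemma perms_of_aut P (G : {group cat_aut T P}) :
  perms_of P [set ts_pi (aut_mor u) | u in G] = @aut_perm P @* G.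
Proof.
apply/setP=> a; apply/setIdP/morphimP=> [[Aa /imsetP[u Gu ea]] | [u _ Gu ->]].
  exists u^-1; rewrite ?inE ?groupV //; have [Au ru] := aut_permP u^-1.
  by apply: (resf_Aut_inj Aa Au); rewrite ru invgK.
have [Au ru] := aut_permP u; split; rewrite // ru.
by apply/imsetP; exists u^-1; rewrite ?groupV.
Qed.

End Transporter.

(** * The permutation representation and the system it generates *)

Section Theta.
Variables (p : nat) (gT : finGroupType) (F : fusion_system gT).
Variables (T : transporter_system p F) (X : finType) (theta : mor_rep T X).
Implicit Types P Q R : objs (ts_ob T).

Local Notation l := (theta_action theta).

Lemma rep_inc P Q (sPQ : P \subset Q) : theta P Q (inc sPQ) = 1.
Proof. exact: rep_incl. Qed.

Lemma rep_idm P : theta P P (idm T P) = 1.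
Proof. by rewrite -ts_delta1 rep_incl. Qed.

Lemma rep_delta P Q (s : ntrans P Q) : theta P Q (ts_delta T P Q s) = l (val s).
Proof.
have sT R : R \subset ts_top T by apply: subsetT.
have <- : theta _ _ (comp (inc (sT Q)) (ts_delta T P Q s)) =
    theta P Q (ts_delta T P Q s) by rewrite repM rep_inc mulg1.
have -> : comp (inc (sT Q)) (ts_delta T P Q s) =
    comp (ts_delta T (ts_top T) (ts_top T) (trans_top (val s))) (inc (sT P)).
  rewrite /inc -!ts_deltaM; congr (ts_delta T _ _ _).
  by apply: val_inj; rewrite /= mul1g mulg1.
by rewrite repM rep_inc mul1g.
Qed.

Lemma rep_dmor P s : s \in 'N(P) -> theta P P (dmor P s) = l s.
Proof. by case/dmorP=> u <- ->; rewrite rep_delta. Qed.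

Lemma rep_tinv P Q (g : T P Q) h : tinv g h -> theta Q P h = (theta P Q g)^-1.
Proof.
case=> hg _; apply: (mulgI (theta P Q g)).
by rewrite mulgV -repM hg rep_idm.
Qed.

(** ** Morphisms of the generated system *)

Lemma objs_codom P (Q : {group gT}) f : f \in F P Q ->
  exists Q' : objs (ts_ob T), val Q' = Q.
Proof.
case/fhom_image=> R [_ sRQ isoR].
have HR : R \in ts_ob T.
  by case: (ts_ob_closed T) => /(_ (val P) R (valP P)) + _; apply; exists f.
exact: (@objs_over _ _ _ T (exist _ R HR) Q sRQ).
Qed.

Definition pair_of P Q (g : T P Q) : pairs gT X := (ts_pi g, theta P Q g).

Lemma pair_of_comp P Q R (h : T Q R) (g : T P Q) :
  pair_of (comp h g) = pcomp (pair_of h) (pair_of g).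
Proof. by rewrite /pair_of /pcomp ts_piM repM. Qed.

Lemma pair_of_idm P : pair_of (idm T P) = idp X P.
Proof. by rewrite /pair_of ts_pi1 rep_idm. Qed.

Definition from_theta (P : {group gT}) (Q : {group gT}) (m : pairs gT X) :=
  forall P' : objs (ts_ob T), val P' = P ->
  exists (Q' : objs (ts_ob T)) (g : T P' Q'), val Q' = Q /\ m = pair_of g.

(** A system containing the generated one, and small enough to describe its
   morphisms between objects: pairs with first component in F that come from T
   whenever the source is an object.  Over the other subgroups every
   intertwining permutation is admitted; since F-conjugate subgroups are both
   objects or both not, passing to images and inverses stays within one case. *)
Definition big_hom (P Q : {group gT}) : {set pairs gT X} :=
  [set m in intertwined l P Q | (m.1 \in F P Q) && `[< from_theta P Q m >]].

Lemma big_homP (P Q : {group gT}) m :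
  reflect [/\ m \in intertwined l P Q, m.1 \in F P Q & from_theta P Q m]
          (m \in big_hom P Q).
Proof.
apply: (iffP setIdP) => [[Im /andP[Fm /asboolP]] | [Im Fm /asboolP fm]] //.
by rewrite Im Fm.
Qed.

Fact big_intertwined (P Q : {group gT}) : big_hom P Q \subset intertwined l P Q.
Proof. by apply/subsetP=> m /big_homP[]. Qed.

Fact big_comp (P Q R : {group gT}) m n :
  m \in big_hom P Q -> n \in big_hom Q R -> pcomp n m \in big_hom P R.
Proof.
case/big_homP=> Im Fm thm /big_homP[In Fn thn]; apply/big_homP; split.
- exact: intertwined_comp Im In.
- exact: fhom_comp Fm Fn.
move=> P' /thm[Q' [g [/thn[R' [h [eR ->]]] ->]]].
by exists R', (comp h g); rewrite pair_of_comp.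
Qed.

Fact big_conj (P Q : {group gT}) s :
  s \in transp P Q -> (conjf P s, l s) \in big_hom P Q.
Proof.
move=> Ps; apply/big_homP; split=> [||P' eP'].
- exact: intertwined_conj.
- exact: fhom_conj.
have [|Q' eQ'] := @objs_codom P' Q (conjf P s); first by rewrite /obj_group eP' fhom_conj.
rewrite -eP' -eQ' in Ps *; pose u : ntrans P' Q' := exist _ s Ps.
by exists Q', (ts_delta T P' Q' u); split; rewrite // /pair_of ts_pi_delta rep_delta.
Qed.

Fact big_factor (P Q : {group gT}) m : m \in big_hom P Q ->
  exists (R : {group gT}) (n : pairs gT X),
    [/\ R \subset Q, xiso big_hom P R n & m = pcomp (idp X R) n].
Proof.
case/big_homP=> Im Fm thm; have [R [eR sRQ [FRm [h [Fh hm mh]]]]] := fhom_image Fm.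
have ImR : m \in intertwined l P R.
  by case/intertwinedP: Im => *; apply/intertwinedP; rewrite eR; split.
have [Ik km mk] := intertwined_inv ImR (esym eR); set k := (_, _) in Ik km mk.
have ek : k.1 = h.
  have Ik1 : k.1 \in Inj R P by move: Ik; rewrite inE => /andP[].
  rewrite -(fcomp_idl Ik1) -hm.
  have -> : fcomp (fcomp h m.1) k.1 = fcomp h (fcomp m.1 k.1).
    by apply/ffunP=> x; rewrite !ffunE.
  have -> : fcomp m.1 k.1 = idf R by case: mk.
  exact: fcomp_idr (fhomI Fh).
have thR P' : val P' = P -> exists (R' : objs (ts_ob T)) (g : T P' R') h',
    [/\ val R' = R, tinv g h' & m = pair_of g].
  move=> eP'; have [Q' [g [eQ' em]]] := thm P' eP'.
  have [R' [sRQ' [g0 [h0 [eR' gh0 eg]]]]] := ts_image g.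
  exists R', g0, h0; split=> //.
    by apply/val_inj; rewrite /= eR [LHS]eR' em -eP'.
  rewrite em /pair_of eg ts_piM ts_pi_inc repM rep_inc mulg1; congr (_, _).
  exact: fcomp_idl (ts_pi_Inj g0).
exists R, m; split; rewrite ?(pcomp_idp ImR) //; split.
  apply/big_homP; split=> // P' /thR[R' [g [h' [? _ ?]]]].
  by exists R', g.
exists k; split=> //; apply/big_homP; split=> //; first by rewrite ek.
move=> R1 eR1; have [|P' eP'] := @objs_codom R1 P h; first by rewrite /obj_group eR1.
have [R' [g [h' [eR' gh' em]]]] := thR P' eP'.
have {eR'} eR' : R1 = R' by apply: val_inj; rewrite eR1.
exists P'; rewrite eR'; exists h'; split=> //.
have [hg gh] := gh'.
rewrite -(pcomp_idr Ik) -eR1 eR' -pair_of_idm -gh pair_of_comp pcompA -em km -eP'.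
by rewrite -pair_of_idm -pair_of_comp comp1m.
Qed.

Definition big_system : fusion_action_system l :=
  FusionActionSystem big_intertwined big_comp big_conj big_factor.

Lemma Xtheta_big (P Q : {group gT}) : Xtheta theta P Q \subset big_hom P Q.
Proof.
apply: (@Xtheta_min _ _ _ _ _ _ big_system) => P1 Q1 g; apply/big_homP; split.
- exact: theta_intertwined.
- exact: ts_pi_hom.
by move=> P' /val_inj ->; exists Q1, g.
Qed.

Lemma XthetaP P Q m :
  m \in Xtheta theta P Q <-> exists g : T P Q, m = pair_of g.
Proof.
split=> [|[g ->]]; last exact: Xtheta_contains.
case/(subsetP (Xtheta_big P Q))/big_homP => _ _ /(_ P erefl).
by case=> Q' [g [/val_inj eQ em]]; rewrite -eQ; exists g.
Qed.

Local Notation U := (underlying (Xtheta theta)).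

Lemma tiso_fconj P Q : tiso P Q -> fconj U P Q.
Proof.
case=> g [h [hg gh]]; exists (ts_pi g); split.
  by apply/imsetP; exists (pair_of g) => //; apply/XthetaP; exists g.
exists (ts_pi h); rewrite -!ts_piM hg gh !ts_pi1; split=> //.
by apply/imsetP; exists (pair_of h) => //; apply/XthetaP; exists h.
Qed.

Lemma xiso_tinv P Q m : xiso (Xtheta theta) P Q m ->
  exists (g : T P Q) h, tinv g h /\ m = pair_of g.
Proof.
case=> /XthetaP[g ->] [k [/XthetaP[h ->] [hg _] [gh _]]].
have [h' gh'] : exists h', tinv g h'.
  apply: ts_iso; split; first exact: ts_pi_hom.
  by exists (ts_pi h); split=> //; apply: ts_pi_hom.
by exists g, h'.
Qed.

Lemma fconj_tiso P (Q : {group gT}) : fconj U P Q ->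
  exists2 Q' : objs (ts_ob T), val Q' = Q & tiso P Q'.
Proof.
case=> f [/imsetP[m Xm ef] [f' [/imsetP[m' Xm' ef'] f'f ff']]].
have [|Q' eQ'] := @objs_codom P Q f.
  by case/(subsetP (Xtheta_big _ _))/big_homP: Xm => _ Fm _; rewrite ef.
exists Q' => //; rewrite -eQ' in Xm Xm' ff'.
have [g em] := (XthetaP P Q' m).1 Xm; have [h em'] := (XthetaP Q' P m').1 Xm'.
exists g; apply: ts_iso; split; first exact: ts_pi_hom.
exists (ts_pi h); rewrite em /= in ef; rewrite em' /= in ef'; rewrite -ef -ef'.
by split=> //; rewrite ef'; apply: ts_pi_hom.
Qed.

Lemma max_in_classP (m : {group gT} -> nat) P :
  max_in_class U m P <-> tmax m P.
Proof.
split=> maxP Q; first by move/tiso_fconj; apply: maxP.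
by case/fconj_tiso=> Q' <- /maxP.
Qed.

(** ** The kernel of theta *)

Fact rep_ker_group_set P :
  group_set [set u : cat_aut T P | theta P P (aut_mor u) == 1].
Proof.
apply/group_setP; split=> [|u v]; first by rewrite inE aut_mor1 rep_idm.
by rewrite !inE aut_morM repM => /eqP-> /eqP->; rewrite mulg1.
Qed.
Canonical rep_ker P := Group (rep_ker_group_set P).

Lemma rep_kerE P (u : cat_aut T P) :
  (u \in rep_ker P) = (theta P P (aut_mor u) == 1).
Proof. by rewrite inE. Qed.

Lemma rep_autJ P Q (g : T P Q) h (u : cat_aut T P) : tinv g h ->
  theta Q Q (aut_mor (autJ g h u)) = theta P P (aut_mor u) ^ theta P Q g.
Proof. by move=> gh; rewrite aut_ofK !repM (rep_tinv gh) conjgE mulgA. Qed.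

Lemma natural_rep_ker : natural_family rep_ker.
Proof.
move=> P Q g h u gh; rewrite !rep_kerE (rep_autJ _ gh) => /eqP->.
by rewrite conj1g.
Qed.

Lemma daut_pre_rep_ker P : daut P @*^-1 rep_ker P = 'N(P) :&: act_ker l.
Proof.
apply/setP=> s; apply/morphpreP/setIP=> [] [Ns Ks]; split=> //; move: Ks.
  by rewrite rep_kerE aut_ofK rep_dmor // inE.
by rewrite rep_kerE aut_ofK rep_dmor // inE.
Qed.

Lemma natural_ker : natural_family (fun P => (pi_ker P :&: rep_ker P)%G).
Proof. exact: natural_setI (@natural_pi_ker _ _ _ T) natural_rep_ker. Qed.

Lemma daut_pre_ker P :
  daut P @*^-1 (pi_ker P :&: rep_ker P) = 'C(P) :&: act_ker l.
Proof.
rewrite morphpreI daut_pre_pi_ker daut_pre_rep_ker setIA.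
by rewrite (setIidPl (cent_sub P)).
Qed.

(** ** The groups of pairs as images of automorphism groups *)

Definition rep_aut P (u : cat_aut T P) : {perm X} := theta P P (aut_mor u^-1).

Lemma rep_autM P : {in [set: cat_aut T P] &, {morph @rep_aut P : u v / u * v}}.
Proof. by move=> u v _ _; rewrite /rep_aut invMg aut_morM repM. Qed.
Canonical rep_aut_morphism P := Morphism (@rep_autM P).

Lemma rep_aut_image P (G : {group cat_aut T P}) :
  [set theta P P (aut_mor u) | u in G] = @rep_aut P @* G.
Proof.
apply/setP=> a; apply/imsetP/morphimP=> [[u Gu ->] | [u _ Gu ->]].
  by exists u^-1; rewrite ?inE ?groupV //= /rep_aut invgK.
by exists u^-1; rewrite ?groupV.
Qed.

Definition pair_aut P (u : cat_aut T P) := (aut_perm u, rep_aut u).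

Lemma pair_autM P : {in [set: cat_aut T P] &, {morph @pair_aut P : u v / u * v}}.
Proof. by move=> u v Gu Gv; rewrite /pair_aut aut_permM // rep_autM. Qed.
Canonical pair_aut_morphism P := Morphism (@pair_autM P).

Lemma pair_perms_of_aut P (G : {group cat_aut T P}) :
  pair_perms_of P [set pair_of (aut_mor u) | u in G] = @pair_aut P @* G.
Proof.
apply/setP=> -[a b]; apply/setIdP/morphimP.
  case=> /= Aa /imsetP[u Gu [ea ->]].
  exists u^-1; rewrite ?inE ?groupV //; have [Au ru] := aut_permP u^-1.
  rewrite /= /pair_aut /rep_aut invgK; congr (_, _).
  by apply: (resf_Aut_inj Aa Au); rewrite ru invgK.
case=> u _ Gu [-> ->]; have [Au ru] := aut_permP u; split; rewrite //= ru.
by apply/imsetP; exists u^-1; rewrite ?groupV.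
Qed.

Lemma Xtheta_aut P :
  Xtheta theta P P = [set pair_of (aut_mor u) | u in [set: cat_aut T P]].
Proof.
apply/setP=> m; apply/idP/imsetP=> [/XthetaP[g ->] | [u _ ->]].
  by exists (aut_of g); rewrite ?inE ?aut_ofK.
by apply/XthetaP; exists (aut_mor u).
Qed.

Lemma pair_of_dmor P s : s \in 'N(P) -> pair_of (dmor P s) = (conjf P s, l s).
Proof. by move=> Ns; rewrite /pair_of ts_pi_dmor ?rep_dmor. Qed.

Lemma imset_daut (rT : finType) P (f : T P P -> rT) (A : {set gT}) :
    A \subset 'N(P) ->
  [set f (aut_mor u) | u in daut P @* A] = [set f (dmor P s) | s in A].
Proof.
move=> sAN; rewrite morphimEsub // -imset_comp; apply: eq_imset => s /=.
by rewrite aut_ofK.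
Qed.

Lemma conjSX_aut P :
  conjSX l P = [set pair_of (aut_mor u) | u in daut P @* 'N(P)].
Proof.
by rewrite imset_daut //; apply: eq_in_imset => s Ns; rewrite pair_of_dmor.
Qed.

(** * Saturation *)

Hypothesis pS : p.-group [set: gT].

Lemma und_aut P :
  U P P = [set ts_pi (aut_mor u) | u in [set: cat_aut T P]].
Proof. by rewrite [LHS]/(und_hom _ _ _) /und_hom Xtheta_aut -imset_comp. Qed.

Lemma conjS_aut P (A : {set gT}) : A \subset 'N(P) ->
  [set conjf P s | s in A] = [set ts_pi (aut_mor u) | u in daut P @* A].
Proof.
move=> sAN; rewrite (imset_daut (@ts_pi _ _ _ T P P)) //.
by apply: eq_in_imset => s /(subsetP sAN) Ns; rewrite ts_pi_dmor.
Qed.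

Lemma lact_aut P (A : {set gT}) : A \subset 'N(P) ->
  [set l s | s in A] = [set theta P P (aut_mor u) | u in daut P @* A].
Proof.
move=> sAN; rewrite (imset_daut (theta P P)) //.
by apply: eq_in_imset => s /(subsetP sAN) Ns; rewrite rep_dmor.
Qed.

Lemma normalized_Sylow P : fully_normalized U P ->
  [/\ p.-Sylow(autF U P) (autS P), p.-Sylow(autX (Xtheta theta) P) (autSX l P)
    & p.-Sylow(sigmaX (Xtheta theta) P) (sigmaS l P)].
Proof.
move/max_in_classP => /(daut_Sylow pS) sylN; split.
- rewrite /autF und_aut /autS /conjS conjS_aut // !perms_of_aut.
  exact: (morphim_pHall (aut_perm_morphism P) (subsetT _) sylN).
- rewrite /autX Xtheta_aut /autSX conjSX_aut !pair_perms_of_aut.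
  exact: (morphim_pHall (pair_aut_morphism P) (subsetT _) sylN).
rewrite /sigmaX Xtheta_aut -imset_comp /sigmaS (@lact_aut P) //= !rep_aut_image.
exact: (morphim_pHall (rep_aut_morphism P) (subsetT _) sylN).
Qed.

Lemma X_normalizedP P : fully_X_normalized (Xtheta theta) P <->
  p.-Sylow(rep_ker P) (daut P @* 'N(P) :&: rep_ker P).
Proof.
rewrite /fully_X_normalized max_in_classP.
by apply: (natural_SylowP pS natural_rep_ker) => Q; rewrite daut_pre_rep_ker.
Qed.

Lemma centralizedP P : fully_centralized U P <->
  p.-Sylow(pi_ker P) (daut P @* 'N(P) :&: pi_ker P).
Proof.
rewrite /fully_centralized max_in_classP.
by apply: (natural_SylowP pS (@natural_pi_ker _ _ _ T)) => Q; rewrite daut_pre_pi_ker.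
Qed.

Lemma X_centralizedP P : fully_X_centralized (Xtheta theta) P <->
  p.-Sylow(pi_ker P :&: rep_ker P) (daut P @* 'N(P) :&: (pi_ker P :&: rep_ker P)).
Proof.
rewrite /fully_X_centralized max_in_classP.
by apply: (natural_SylowP pS natural_ker) => Q; rewrite daut_pre_ker.
Qed.

Lemma Xtheta_full P :
  [/\ fully_normalized U P -> fully_X_normalized (Xtheta theta) P,
      fully_normalized U P -> fully_centralized U P,
      fully_X_normalized (Xtheta theta) P -> fully_X_centralized (Xtheta theta) P
    & fully_centralized U P -> fully_X_centralized (Xtheta theta) P].
Proof.
have natT := @natural_setT _ _ _ T.
have natE := @natural_pi_ker _ _ _ T.
have sylT : fully_normalized U P ->
    p.-Sylow([set: cat_aut T P]) (daut P @* 'N(P) :&: [set: cat_aut T P]).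
  by move/max_in_classP => /(daut_Sylow pS); rewrite setIT.
split.
- move/sylT=> /(natural_Sylow_sub natT natural_rep_ker (subsetT _)) ?.
  exact/X_normalizedP.
- move/sylT=> /(natural_Sylow_sub natT natE (subsetT _)) ?.
  exact/centralizedP.
- move/X_normalizedP.
  move=> /(natural_Sylow_sub natural_rep_ker natural_ker (subsetIr _ _)) ?.
  exact/X_centralizedP.
move/centralizedP=> /(natural_Sylow_sub natE natural_ker (subsetIl _ _)) ?.
exact/X_centralizedP.
Qed.

Lemma daut_meetE P (M : {group cat_aut T P}) :
  daut P @* (daut P @*^-1 M) = daut P @* 'N(P) :&: M.
Proof. by rewrite -morphpreIim morphpreK ?subsetIl. Qed.

Lemma X_normalized_Sylow P : fully_X_normalized (Xtheta theta) P ->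
  p.-Sylow(autF0 (Xtheta theta) P) (autS0 l P).
Proof.
move/X_normalizedP => sylK.
have -> : autF0 (Xtheta theta) P = @aut_perm _ _ _ T P @* rep_ker P.
  rewrite -perms_of_aut; congr (perms_of P _); apply/setP=> f; rewrite inE.
  rewrite Xtheta_aut; apply/imsetP/imsetP=> [[u _ [-> Ku]] | [u Ku ->]].
    by exists u; rewrite // rep_kerE -Ku.
  by exists u; rewrite // /pair_of; move: Ku; rewrite rep_kerE => /eqP->.
rewrite /autS0 -daut_pre_rep_ker conjS_aut ?subsetIl // perms_of_aut.
rewrite -daut_meetE in sylK.
exact: (morphim_pHall (aut_perm_morphism P) (subsetT _) sylK).
Qed.

Lemma centralized_Sylow P : fully_centralized U P ->
  p.-Sylow(sigmaX0 (Xtheta theta) P) (sigmaS0 l P).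
Proof.
move/centralizedP => sylE.
have -> : sigmaX0 (Xtheta theta) P = @rep_aut P @* pi_ker P.
  rewrite -rep_aut_image; apply/setP=> a; rewrite inE.
  rewrite Xtheta_aut; apply/imsetP/imsetP=> [[u _ [Eu ->]] | [u Eu ->]].
    by exists u; rewrite // pi_kerE -Eu.
  by exists u; rewrite // /pair_of; move: Eu; rewrite pi_kerE => /eqP->.
rewrite /sigmaS0 -daut_pre_pi_ker (@lact_aut P) ?subsetIl // rep_aut_image.
rewrite -daut_meetE in sylE.
exact: (morphim_pHall (rep_aut_morphism P) (subsetT _) sylE).
Qed.

Lemma ker_pair P (u v : cat_aut T P) : pair_of (aut_mor u) = pair_of (aut_mor v) ->
  u * v^-1 \in pi_ker P :&: rep_ker P.
Proof.
case=> piuv thuv; rewrite inE pi_kerE rep_kerE ts_pi_autM aut_morM repM.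
have [_ vV] := aut_morVK v.
by rewrite piuv thuv -ts_piM -repM vV ts_pi1 rep_idm !eqxx.
Qed.

(** D is Sylow in M D, as the index of D there is that of D :&: M in M.  The
   element of M D given by Sylow's theorem may be taken in M since D normalizes
   itself. *)
Lemma Sylow_mul_conj (rT : finGroupType) (M D J : {group rT}) :
    D \subset 'N(M) -> p.-group D -> p.-Sylow(M) (D :&: M) ->
    p.-group J -> J \subset M * D ->
  exists2 k, k \in M & J :^ k \subset D.
Proof.
move=> nMD pD sylM pJ; rewrite -norm_joinEr // => sJMD.
have sylD : p.-Sylow(M <*> D) D.
  rewrite /pHall joing_subr pD norm_joinEr //= -(normC nMD) indexMg -indexgI setIC.
  by case/and3P: sylM.
have [x] := Sylow_Jsub sylD sJMD pJ.
rewrite /= norm_joinEr // => /mulsgP[k d Mk Dd ->]; rewrite conjsgM => sJD.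
by exists k; rewrite // -(conjSg _ _ d) (conjGid Dd).
Qed.

End Theta.

Section Extension.
Variables (p : nat) (gT : finGroupType) (F : fusion_system gT).
Variables (T : transporter_system p F) (X : finType) (theta : mor_rep T X).
Implicit Types P Q R : objs (ts_ob T).
Hypothesis pS : p.-group [set: gT].

Local Notation l := (theta_action theta).

Lemma invf_tinv P Q (g : T P Q) h : tinv g h -> invf P (ts_pi g) = ts_pi h.
Proof.
case=> _ gh; apply/ffunP=> y; rewrite ffunE.
have [Qy | Qy] := boolP (y \in Q); last first.
  case: pickP => [x /andP[Px /eqP xy]|_ /=].
    by rewrite -xy ts_pi_mem in Qy.
  by case/InjP: (ts_pi_Inj h) => ->.
have ey : y = ts_pi g (ts_pi h y).
  move: gh => /(congr1 (@ts_pi _ _ _ _ _ _))/ffunP/(_ y).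
  by rewrite ts_piM ts_pi1 !ffunE Qy.
have Phy : ts_pi h y \in P by apply: ts_pi_mem.
case: pickP => [x /andP[Px /eqP xy]|/(_ (ts_pi h y))].
  by case/InjP: (ts_pi_Inj g) => _ _ gI _; apply: gI => //; rewrite -ey.
by rewrite -ey Phy eqxx.
Qed.

(** Membership in N_(phi, sigma) compares two automorphisms of Q in T through
   the pairs they induce; if these agree, the automorphisms differ by an
   element of the intersection of E(Q) and K(Q) ([ker_pair]). *)
Lemma mem_NxP P Q (g : T P Q) h n : tinv g h ->
  reflect (n \in 'N(P) /\ exists2 s, s \in 'N(Q) &
             pair_of theta (aut_mor (autJ g h (daut P n))) =
             pair_of theta (aut_mor (daut Q s)))
          (n \in Nx l P Q (pair_of theta g)).
Proof.
move=> gh; apply: (iffP setIdP) => -[Nn]; rewrite /pair_of /= (invf_tinv gh).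
  case/imsetP=> s Ns es; split=> //; exists s => //.
  rewrite rep_autJ // !aut_ofK !ts_piM !ts_pi_dmor // !rep_dmor //.
case=> s Ns; rewrite rep_autJ // !aut_ofK !ts_piM !ts_pi_dmor // !rep_dmor // => es.
by split=> //; apply/imsetP; exists s.
Qed.

Lemma Xtheta_extend P Q m :
    fully_X_centralized (Xtheta theta) Q -> xiso (Xtheta theta) P Q m ->
  exists2 f, (f, m.2) \in Xtheta theta <<Nx l P Q m>>%G [set: gT]%G
    & resf P f = m.1.
Proof.
move/(X_centralizedP _ pS) => sylM /xiso_tinv[g [h [gh em]]].
pose M := (pi_ker Q :&: rep_ker theta Q)%G.
have nM (D : {set cat_aut T Q}) : D \subset 'N(M).
  have /andP[_ nMT] := natural_normal (natural_ker (theta:=theta)) Q.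
  exact: subset_trans (subsetT D) nMT.
have NxJ n : n \in Nx l P Q m ->
    n \in 'N(P) /\ autJ g h (daut P n) \in M * daut Q @* 'N(Q).
  rewrite em => /(mem_NxP _ gh)[Nn [s Ns es]]; split=> //.
  rewrite -[autJ _ _ _](mulgKV (daut Q s)) mem_mulg ?mem_morphim //.
  exact: ker_pair.
set A := <<_>>%G.
have sAN : A \subset 'N(P) by rewrite gen_subG; apply/subsetP=> n /NxJ[].
(* By axiom (C), conjugation by g carries delta(x) to delta(ts_pi g x). *)
have sPA : P \subset A.
  apply/subsetP=> x Px; apply: mem_gen; rewrite em; apply/(mem_NxP _ gh).
  split; first exact: (subsetP (normG P)).
  exists (ts_pi g x); first by rewrite (subsetP (normG Q)) ?ts_pi_mem.
  congr (pair_of theta _); rewrite !aut_ofK compA -dmor_C // -compA.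
  by case: gh => _ ->; rewrite compm1.
pose J := (Morphism (autJM gh) @* (daut P @* A))%G.
have pJ : p.-group J := morphim_pgroup _ (pgroup_daut pS P A).
have [k Mk sJD] : exists2 k, k \in M & J :^ k \subset daut Q @* 'N(Q).
  apply: (Sylow_mul_conj (nM _) (pgroup_daut pS _ _) sylM pJ).
  rewrite -(norm_joinEr (nM _)) sub_morphim_pre ?subsetT // sub_morphim_pre // gen_subG.
  apply/subsetP=> n /NxJ[Nn]; rewrite -(norm_joinEr (nM _)) => Jn.
  by apply/morphpreP; split=> //; apply/morphpreP; split; first rewrite inE.
have [A' eA] : exists A' : objs (ts_ob T), val A' = A by apply: objs_over sPA.
have [N eN] : exists N : objs (ts_ob T), val N = 'N(Q)%G := objs_over (normG Q).
have nPA : P <| A' by rewrite /normal /obj_group eA sPA.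
have nQN : Q <| N by rewrite /normal /obj_group eN normG subxx.
pose g' := comp (aut_mor k^-1) g; pose h' := comp h (aut_mor k).
have [h'g' g'h'] : tinv g' h'.
  by have := tinv_comp gh (aut_morVK k^-1); rewrite invgK.
have [|g1 eg1] := ts_extend nPA nQN h'g' g'h'.
  move=> s As; have {}As : val s \in A by rewrite -eA.
  have Ns : val s \in 'N(P) := subsetP sAN _ As.
  have : autJ g h (daut P (val s)) ^ k \in daut Q @* 'N(Q).
    apply: (subsetP sJD); rewrite memJ_conjg.
    by apply: mem_morphim; rewrite ?inE // mem_morphim.
  case/morphimP=> t Nt _ et; have [u ut du] := dmorP Nt.
  exists u; first by rewrite ut /obj_group eN.
  rewrite -du -(aut_ofK (dmor Q t)) -[aut_of _]et conjgE !aut_morM !aut_ofK dmorE.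
  by rewrite !compA.
have sNT : N \subset ts_top T by apply: subsetT.
have ek : ts_pi (aut_mor k^-1) = idf Q /\ theta Q Q (aut_mor k^-1) = 1.
  have := groupVr Mk; rewrite inE pi_kerE rep_kerE => /andP[/eqP-> /eqP->].
  by [].
exists (ts_pi (comp (inc sNT) g1)).
  rewrite -eA; apply/(XthetaP theta A' (ts_top T)); exists (comp (inc sNT) g1).
  congr (_, _); rewrite em repM rep_inc mulg1 /=.
  move/(congr1 (theta _ _)): eg1; rewrite !repM !rep_incl mulg1 mul1g => ->.
  by case: ek => _ ->; rewrite mulg1.
rewrite em /= ts_piM ts_pi_inc (fcomp_idl (ts_pi_Inj g1)).
have := congr1 (@ts_pi _ _ _ _ _ _) eg1; rewrite !ts_piM !ts_pi_inc.
case: ek => -> _; rewrite (fcomp_idl (ts_pi_Inj g)) (fcomp_idl (ts_pi_Inj g)) => <-.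
apply/ffunP=> x; rewrite !ffunE; case: ifP => // _.
by rewrite (Inj_one (ts_pi_Inj g1)).
Qed.

Lemma Xtheta_closed : closed_conj_over (underlying (Xtheta theta)) (ts_ob T).
Proof.
split=> [P Q HP|P Q HP sPQ]; last by case: (ts_ob_closed T) => _; apply; [apply: HP|].
by case/(@fconj_tiso _ _ _ _ _ theta (exist _ P HP)) => Q' <- _; apply: valP.
Qed.

End Extension.

Theorem corollary3p4p12 (p : nat) (gT : finGroupType) (F : fusion_system gT)
    (T : transporter_system p F) (X : finType) (theta : mor_rep T X)
    (p_prime : prime p) (pS : (p.-group [set: gT])%g) (satF : saturated p F) :
  H_saturated p (Xtheta theta) (ts_ob T).
Proof.
split; first exact: Xtheta_closed.
- by move=> P HP; exact: (Xtheta_full theta pS (exist _ P HP)).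
- by move=> P HP; exact: (@normalized_Sylow _ _ _ _ _ theta pS (exist _ P HP)).
- by move=> P HP; exact: (@X_normalized_Sylow _ _ _ _ _ theta pS (exist _ P HP)).
- by move=> P HP; exact: (@centralized_Sylow _ _ _ _ _ theta pS (exist _ P HP)).
move=> P Q m HP HQ.
exact: (@Xtheta_extend _ _ _ _ _ theta pS (exist _ P HP) (exist _ Q HQ)).
Qed.
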